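(* Let $W_n=(X_n,Y_n)$, $n\ge1$, be i.i.d. with $X_n\sim N(\mu_0,\sigma^2)$ and $Y_n\sim N(\mu_1,\sigma^2)$ independent, $\sigma^2>0$ known, and set $\theta=\mu_1-\mu_0$, $\mu=(\mu_0+\mu_1)/2$. Consider testing $\theta=0$ against $\theta\neq0$. Consider any prior for the pair $(\theta,\mu)$ under the alternative such that marginally $\theta\sim N(0,\tau^2)$, $\tau>0$. For $\gamma>0$ let $\rho_\gamma(M,\alpha)$ be the average over this prior of the relative run-length of the two-stream mSPRT with mixing distribution $H=N(0,\gamma^2)$ truncated at $M$. Then, to leading order as $\alpha\to0$, $M\to\infty$, $M=O(\log(\alpha^{-1}))$, $\rho_\gamma(M,\alpha)$ is minimized over $\gamma$ by $\gamma^*$ given by $$(\gamma^* )^2=\tau^2\,\frac{\Phi(-b)}{\frac1b\phi(b)-\Phi(-b)},\qquad b=\Big(\frac{2\sigma^2\log\alpha^{-1}}{M\tau^2}\Big)^{1/2},$$ i.e. $\rho_{\gamma^*}(M,\alpha)\le\rho_\gamma(M,\alpha)(1+o(1))$ for every $\gamma>0$.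
   Context: $\phi,\Phi$ are the standard normal density and distribution function. Two-stream mSPRT: with $D_n=\frac1n\sum_{i=1}^n(Y_i-X_i)$, $$\Lambda^H_n=\int_{\mathbb R}\left(\frac{\phi\big(\frac{D_n-\theta}{\sigma\sqrt2}\big)}{\phi\big(\frac{D_n}{\sigma\sqrt2}\big)}\right)^n dH(\theta),\qquad T^H(\alpha)=\inf\{n:\Lambda^H_n\ge\alpha^{-1}\}.$$ The test truncated at a positive integer $M$ stops at $\min\{T^H(\alpha),M\}$ and rejects iff $T^H(\alpha)\le M$; its relative run-length at $(\theta,\mu)$ is $\mathbb E_{\theta,\mu}(\min\{T^H(\alpha),M\})/M$ (which does not depend on $\mu$). *)

(* Defs.v *)
From HB Require Import structures.
From mathcomp Require Import all_boot all_order all_algebra.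
From mathcomp Require Import finmap.
From mathcomp Require Import all_classical all_reals all_analysis.

Set Implicit Arguments.
Unset Strict Implicit.
Unset Printing Implicit Defensive.

Import Order.TTheory GRing.Theory Num.Theory.
Import numFieldNormedType.Exports.

Local Open Scope classical_set_scope.
Local Open Scope ring_scope.

(* The library's normal laws live on [measurableTypeR R], which has the same
   measurable sets as the canonical instance on [R]. The values of a measure
   outside measurable sets carry no meaning, hence the restriction on [A]. *)
Definition has_law d (T : measurableType d) (R : realType)
    (P : probability T R) (Z : {mfun T >-> R}) (Q : probability (measurableTypeR R) R) : Prop :=
  forall A : set R, measurable A -> distribution P Z A = Q A.

Definition independent_pair d (T : measurableType d) (R : realType)
    (P : probability T R) d' (U : measurableType d') (X Y : T -> U) : Prop :=
  forall A B : set U, measurable A -> measurable B ->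
    P (X @^-1` A `&` Y @^-1` B) = (P (X @^-1` A) * P (Y @^-1` B))%E.

Definition mutually_independent d (T : measurableType d) (R : realType)
    (P : probability T R) d' (U : measurableType d') (W : nat -> T -> U) : Prop :=
  forall (J : {fset nat}) (A : nat -> set U), (forall i, measurable (A i)) ->
    P (\bigcap_(i in [set` J]) (W i @^-1` A i)) =
      (\prod_(i <- J) P (W i @^-1` A i))%E.

(* Streams are indexed from 0: [X i] and [Y i] are the (i+1)-st observations.
   The pairs are identically distributed because their law is the product of
   the two prescribed marginals. *)
Definition two_stream_normal d (T : measurableType d) (R : realType)
    (P : probability T R) (X Y : nat -> {mfun T >-> R}) (mu0 mu1 sigma : R) : Prop :=
  [/\ mutually_independent P (fun n w => (X n w, Y n w)),
      forall n, independent_pair P (X n) (Y n),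
      forall n, has_law P (X n) (normal_prob mu0 sigma) &
      forall n, has_law P (Y n) (normal_prob mu1 sigma)].

Definition phi (R : realType) (x : R) : R := normal_pdf 0 1 x.

Definition Phi (R : realType) (x : R) : R := fine (normal_prob 0 1 `]-oo, x]).

Definition mean_diff (R : realType) (x y : nat -> R) (n : nat) : R :=
  n%:R^-1 * \sum_(i < n) (y i - x i).

Definition mixture_lr (R : realType) (sigma : R) (H : probability (measurableTypeR R) R)
    (x y : nat -> R) (n : nat) : \bar R :=
  (\int[H]_theta
    ((phi ((mean_diff x y n - theta) / (sigma * Num.sqrt 2)) /
      phi (mean_diff x y n / (sigma * Num.sqrt 2))) ^+ n)%:E)%E.

(* [+oo] when the threshold is never reached ([ereal_inf set0 = +oo]). *)
Definition mSPRT_time (R : realType) (sigma : R) (H : probability (measurableTypeR R) R)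
    (alpha : R) (x y : nat -> R) : \bar R :=
  ereal_inf [set (n%:R)%:E | n in
    [set n : nat | (0 < n)%N /\ (alpha^-1%:E <= mixture_lr sigma H x y n)%E]].

Definition relative_run_length d (T : measurableType d) (R : realType)
    (P : probability T R) (X Y : nat -> {mfun T >-> R}) (sigma : R)
    (H : probability (measurableTypeR R) R) (M : nat) (alpha : R) : \bar R :=
  ((\int[P]_w mine (mSPRT_time sigma H alpha (X ^~ w) (Y ^~ w)) (M%:R)%:E)
    * (M%:R^-1)%:E)%E.

(* [P theta mu] is the sampling law at effect [theta] and average level [mu];
   a point of [R * R] drawn from the prior is the pair (theta, mu). *)
Definition rho d (T : measurableType d) (R : realType)
    (P : R -> R -> probability T R) (X Y : nat -> {mfun T >-> R}) (sigma : R)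
    (prior : probability (R * R)%type R) (gamma : R) (M : nat) (alpha : R)
    : \bar R :=
  (\int[prior]_p
    relative_run_length (P p.1 p.2) X Y sigma (normal_prob 0 gamma) M alpha)%E.

Definition bcoef (R : realType) (sigma tau : R) (M : nat) (alpha : R) : R :=
  Num.sqrt (2 * sigma ^+ 2 * ln alpha^-1 / (M%:R * tau ^+ 2)).

(* For b > 0 the denominator is positive by Mills' bound
   Phi (- b) < phi b / b, so the square root is not degenerate. *)
Definition gamma_star (R : realType) (sigma tau : R) (M : nat) (alpha : R) : R :=
  let b := bcoef sigma tau M alpha in
  Num.sqrt (tau ^+ 2 * (Phi (- b) / (b^-1 * phi b - Phi (- b)))).

(* Main.v *)
(* Write L = ln (1/alpha) and let S_n be the sum of the first n differences,
   with mean n theta and variance 2 sigma^2 n. To leading order the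
   relative run-length at theta is r = min (1, 4 sigma^2 L / (M theta^2)) for
   every mixing scale, so the claim is that gamma cannot beat the average f
   of r and that gamma_star attains it.

   Lower bound, uniform in gamma: the mixture is at most the maximal likelihood
   ratio exp (S_n^2 / (4 sigma^2 n)), hence a crossing at n forces
   |S_n| >= 2 sigma sqrt (n L). Before time (1-q)^2 r M this requires S_n to
   deviate from n theta by 2 q sigma sqrt (n L), which has probability at most
   2 exp (- q^2 L); since M = O(L), the union over n <= M is negligible.

   Upper bound: if M theta^2 <= 4 sigma^2 L (up to a constant factor close to
   1) there is nothing to prove. Otherwise theta is bounded away from 0, and the
   mixture over a small interval around theta already crosses at a time
   n close to 4 sigma^2 L / theta^2, except on an event of small probability.
   This is uniform for gamma in a compact subset of ]0, +oo[ and bounded theta.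

   The exact value of gamma_star is irrelevant at this order: gamma_star stays
   in such a compact set as long as b stays bounded (and b is bounded
   below because M = O(L)), while for large b the average f is close to 1,
   the trivial upper bound. *)
Require Import Defs.
From HB Require Import structures.
From mathcomp Require Import all_boot all_order all_algebra.
From mathcomp Require Import finmap.
From mathcomp Require Import all_classical all_reals all_analysis.
From mathcomp Require Import measurable_realfun.
From mathcomp Require Import ring lra.

Set Implicit Arguments.
Unset Strict Implicit.
Unset Printing Implicit Defensive.

Import Order.TTheory GRing.Theory Num.Theory.
Import numFieldNormedType.Exports.

Local Open Scope classical_set_scope.
Local Open Scope ring_scope.

(** * Independence *)

Section nonneg_integral.
Local Open Scope ereal_scope.
Context d (T : measurableType d) (R : realType).
Variable mu : {measure set T -> \bar R}.

(* Unlike [ge0_le_integral], no measurability is required: the integral of a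
   nonnegative function is a supremum over the simple functions below it. *)
Lemma ge0_le_integral_nonmeasurable (f g : T -> \bar R) :
  (forall x, 0 <= f x) -> (forall x, f x <= g x) ->
  \int[mu]_x f x <= \int[mu]_x g x.
Proof.
move=> f0 fg; rewrite !ge0_integralTE//; last first.
  by move=> x; exact: le_trans (f0 x) (fg x).
apply: le_ereal_sup => _ [h hf <-]; exists h => // x.
exact: le_trans (hf x) (fg x).
Qed.

End nonneg_integral.

Section weighted_pushforward.
Local Open Scope ereal_scope.
Context d (T : measurableType d) d' (U : measurableType d') (R : realType).
Variables (mu : {measure set T -> \bar R}) (nu : {measure set U -> \bar R}).

Import HBNNSimple.

(** Both sides agree on indicators, hence on simple functions by linearity and on nonnegative
    functions by monotone convergence. It serves independence, with [nu] a scaled law, and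
    densities, with [W] the identity. *)
Lemma ge0_integral_weighted_pushforward (Z : T -> R) (W : T -> U) (f : U -> R) :
  measurable_fun setT Z -> (forall x, (0 <= Z x)%R) ->
  measurable_fun setT W ->
  measurable_fun setT f -> (forall u, (0 <= f u)%R) ->
  (forall A, measurable A -> \int[mu]_x (Z x * \1_A (W x))%:E = nu A) ->
  \int[mu]_x (Z x * f (W x))%:E = \int[nu]_u (f u)%:E.
Proof.
move=> mZ Z0 mW mf f0 nuE.
have mEf : measurable_fun setT (EFin \o f) by exact/measurable_EFinP.
pose g := nnsfun_approx measurableT mEf.
have gf u : (g n u)%:E @[n --> \oo] --> (f u)%:E.
  by apply: (@cvg_nnsfun_approx _ _ _ _ measurableT _ mEf) => // x _; rewrite /= lee_fin.
have ndg u : {homo (fun n => g n u) : m n / (m <= n)%N >-> (m <= n)%R}.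
  by move=> m n mn; exact/lefP/nd_nnsfun_approx.
have mgW n : measurable_fun setT (fun x => g n (W x)).
  by apply: measurableT_comp => //; exact: measurable_funP.
have mg n k : measurable (g n @^-1` [set k]) by [].
have mindic A : measurable A -> measurable_fun setT (fun x => \1_A (W x) : R).
  by move=> mA; apply: (measurableT_comp _ mW); exact: measurable_indic.
have simple n : \int[mu]_x (Z x * g n (W x))%:E = \int[nu]_u (g n u)%:E.
  have k0 k u : 0 <= (k * \1_(g n @^-1` [set k]) u)%:E.
    exact: nnfun_muleindic_ge0.
  have mk k : measurable_fun setT (fun x => (k * \1_(g n @^-1` [set k]) (W x))%R).
    by apply: measurable_funM => //; exact: mindic.
  transitivity (\sum_(k \in range (g n))
      \int[mu]_x (Z x * (k * \1_(g n @^-1` [set k]) (W x)))%:E).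
    rewrite -ge0_integral_fsum//.
    - apply: eq_integral => x _; rewrite fimfunE EFinM -fsumEFin//.
      rewrite ge0_mule_fsumr; last exact: (k0 ^~ (W x)).
      by apply: eq_fsbigr => k _; rewrite EFinM.
    - by move=> k; apply/measurable_EFinP; exact: measurable_funM.
    - by move=> k x _; rewrite EFinM mule_ge0// lee_fin.
  transitivity (\sum_(k \in range (g n))
      \int[nu]_u (k * \1_(g n @^-1` [set k]) u)%:E); last first.
    rewrite -ge0_integral_fsum//.
    - by apply: eq_integral => x _; rewrite [in RHS]fimfunE -fsumEFin.
    - by move=> k; apply/measurable_EFinP; exact: measurable_funM.
  apply: eq_fsbigr => k; rewrite inE/= => -[u _ guk].
  have k_ge0 : (0 <= k)%R by rewrite -guk.
  have ZkE : (fun x => (Z x * (k * \1_(g n @^-1` [set k]) (W x)))%:E) =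
      (fun x => k%:E * (Z x * \1_(g n @^-1` [set k]) (W x))%:E).
    by apply/funext => x; rewrite -EFinM mulrCA.
  rewrite ZkE ge0_integralZl//; last 2 first.
  - by apply/measurable_EFinP; apply: measurable_funM => //; exact: mindic.
  - by move=> x _; rewrite lee_fin mulr_ge0.
  by rewrite nuE// integralZl_indic_nnsfun// integral_indic// setIT.
have <- : limn (fun n => \int[mu]_x (Z x * g n (W x))%:E) =
    \int[mu]_x (Z x * f (W x))%:E.
  rewrite -monotone_convergence//.
  - apply: eq_integral => x _; apply/cvg_lim => //.
    by rewrite EFinM; under eq_fun do rewrite EFinM; exact: cvgeZl.
  - by move=> n; apply/measurable_EFinP; exact: measurable_funM.
  - by move=> n x _; rewrite lee_fin mulr_ge0.
  - by move=> x _ m n mn; rewrite lee_fin ler_wpM2l// ndg.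
under eq_fun do rewrite simple.
rewrite -monotone_convergence//.
- by apply: eq_integral => u _; apply/cvg_lim.
- by move=> n; apply/measurable_EFinP; exact: measurable_funP.
- by move=> n u _; rewrite lee_fin.
- by move=> u _ m n mn; rewrite lee_fin ndg.
Qed.

End weighted_pushforward.

Section independence.
Local Open Scope ereal_scope.
Context d (T : measurableType d) (R : realType) (P : probability T R).
Context d' (U : measurableType d').

(** The measure with density [Z] has as image under [W] the law of [W] scaled by the mean of [Z];
    finiteness of that mean makes the scale a real number. *)
Lemma integralM_comp_indep (Z : T -> R) (W : T -> U) (f : U -> R) :
  measurable_fun setT Z -> (forall x, (0 <= Z x)%R) ->
  \int[P]_x (Z x)%:E \is a fin_num ->
  measurable_fun setT W ->
  measurable_fun setT f -> (forall u, (0 <= f u)%R) ->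
  (forall A, measurable A ->
    \int[P]_x (Z x * \1_A (W x))%:E = \int[P]_x (Z x)%:E * P (W @^-1` A)) ->
  \int[P]_x (Z x * f (W x))%:E = \int[P]_x (Z x)%:E * \int[P]_x (f (W x))%:E.
Proof.
move=> mZ Z0 Zfin mW mf f0 indep.
have EZ0 : 0 <= \int[P]_x (Z x)%:E by apply: integral_ge0 => x _; rewrite lee_fin.
have c0 : (0 <= fine (\int[P]_x (Z x)%:E))%R by rewrite fine_ge0.
pose Wm : {mfun T >-> U} := HB.pack W (isMeasurableFun.Build _ _ _ _ W mW).
have mEf : measurable_fun setT (EFin \o f) by exact/measurable_EFinP.
rewrite (ge0_integral_weighted_pushforward
  (nu := mscale (NngNum c0) (distribution P Wm)))//.
  rewrite ge0_integral_mscale// ?fineK//.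
    by rewrite ge0_integral_distribution.
  by move=> u _; rewrite lee_fin.
by move=> A mA; rewrite indep// -[in LHS](fineK Zfin).
Qed.

Lemma expectation_prod_indep (W : nat -> T -> U) (G : nat -> U -> R) n :
  mutually_independent P W ->
  (forall i, measurable_fun setT (W i)) ->
  (forall i, measurable_fun setT (G i)) ->
  (forall i u, (0 <= G i u)%R) ->
  (forall i, \int[P]_x (G i (W i x))%:E \is a fin_num) ->
  \int[P]_x (\prod_(i < n) G i (W i x))%:E =
    \prod_(i < n) \int[P]_x (G i (W i x))%:E.
Proof.
move=> indep mW.
have mWA i A : measurable A -> measurable (W i @^-1` A).
  by move=> mA; rewrite -[_ @^-1` _]setTI; exact: mW.
have int1 i A : measurable A ->
    \int[P]_x (\1_A (W i x) : R)%:E = P (W i @^-1` A).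
  by move=> mA; rewrite (integral_indic _ _ (mWA i _ mA))//= setIT.
(* The factors are upgraded from indicators to functions one at a time:
   those of index at least [k] are still indicators. *)
suff main k : (k <= n)%N -> forall G : nat -> U -> R,
    (forall i, measurable_fun setT (G i)) ->
    (forall i u, (0 <= G i u)%R) ->
    (forall i, \int[P]_x (G i (W i x))%:E \is a fin_num) ->
    (forall i, (k <= i < n)%N -> exists2 A, measurable A & G i = \1_A) ->
    \int[P]_x (\prod_(i < n) G i (W i x))%:E =
      \prod_(i < n) \int[P]_x (G i (W i x))%:E.
  move=> mG G0 Gfin; apply: (main n) => // i.
  by rewrite leqNgt andNb.
elim: k => [_|k IH kn] {}G mG G0 Gfin GA.
  (* Independence asks for a measurable set at every index, so the indices from [n] on get
     [setT]. *)
  have /choice[A AP] i : exists A, measurable A /\ ((i < n)%N -> G i = \1_A).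
    have [ni|ni] := ltnP i n; last by exists setT; split.
    by have [A mA GiA] := GA i ni; exists A; split.
  pose J : {fset nat} := [fset i in iota 0 n]%fset.
  have JE : perm_eq J (index_iota 0 n).
    apply: uniq_perm; rewrite ?fset_uniq ?iota_uniq// => i.
    by rewrite /J in_fset/= /index_iota subn0.
  have := indep J A (fun i => (AP i).1).
  rewrite (perm_big _ JE)/= big_mkord => PE.
  transitivity (P (\bigcap_(i in [set` J]) (W i @^-1` A i))).
    rewrite -[X in _ = P X]setIT -integral_indic//; last first.
      by apply: fin_bigcap_measurable => // i _; apply: mWA; exact: (AP i).1.
    apply: eq_integral => x _; congr EFin; rewrite indicE.
    have inJ i : (i \in J) = (i < n)%N by rewrite (perm_mem JE) mem_index_iota.
    have [xJ|/negP xJ] := boolP (x \in _).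
      apply: big1 => i _; rewrite (AP i).2//= indicE mem_set//.
      by move/set_mem: xJ; apply; rewrite /= inJ.
    apply/eqP/prodf_eq0 => /=.
    have [i ni xi] : exists2 i, (i < n)%N & ~ A i (W i x).
      apply: contra_notP xJ => /forall2NP xJ; rewrite inE => i /=; rewrite inJ => ni.
      by have [//|/contrapT] := xJ i.
    by exists (Ordinal ni) => //=; rewrite (AP i).2// indicE memNset.
  rewrite PE; apply: eq_bigr => i _; rewrite (AP i).2//= int1//; exact: (AP i).1.
(* With an indicator as factor [k] the induction hypothesis applies, which yields independence of
   [Z] and [W k] on sets. *)
pose Gk A i := if i == k then \1_A else G i : U -> R.
have GkE A i : i != k -> Gk A i = G i by rewrite /Gk => /negPf->.
have Gkk A : Gk A k = \1_A by rewrite /Gk eqxx.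
pose Z x := (\prod_(i < n | i != Ordinal kn) G i (W i x))%R.
have mZ : measurable_fun setT Z.
  rewrite /Z; under eq_fun do rewrite -big_filter.
  by apply: measurable_prod => i _; exact: measurableT_comp.
have Z0 x : (0 <= Z x)%R by apply: prodr_ge0.
have split0 A x : (\prod_(i < n) Gk A i (W i x) = Z x * \1_A (W k x))%R.
  rewrite (bigD1 (Ordinal kn))//= Gkk mulrC; congr (_ * _)%R.
  by apply: eq_bigr => i ik; rewrite GkE.
have IHA A : measurable A -> \int[P]_x (Z x * \1_A (W k x))%:E =
    \prod_(i < n | i != Ordinal kn) \int[P]_x (G i (W i x))%:E * P (W k @^-1` A).
  move=> mA; under eq_integral do rewrite -split0.
  rewrite IH ?(ltnW kn)//.
  - rewrite (bigD1 (Ordinal kn))//= Gkk int1// muleC; congr *%E.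
    by apply: eq_bigr => i ik; rewrite GkE.
  - by move=> i; rewrite /Gk; case: ifP => // _; exact: measurable_indic.
  - by move=> i u; rewrite /Gk; case: ifP.
  - move=> i; rewrite /Gk; case: ifP => // _.
    by rewrite int1// fin_num_measure//; exact: mWA.
  - move=> i /andP[]; rewrite leq_eqVlt => /predU1P[<- _|ki ni].
      by exists A.
    by rewrite GkE ?gtn_eqF//; apply: GA; rewrite ki.
have ZE : \int[P]_x (Z x)%:E =
    \prod_(i < n | i != Ordinal kn) \int[P]_x (G i (W i x))%:E.
  have := IHA setT measurableT; rewrite preimage_setT probability_setT mule1 => <-.
  by apply: eq_integral => x _; rewrite indicT mulr1.
rewrite [RHS](bigD1 (Ordinal kn))//= -ZE muleC -integralM_comp_indep//.
- by apply: eq_integral => x _; rewrite (bigD1 (Ordinal kn))//= mulrC.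
- by rewrite ZE; apply: prode_fin_num => i _; exact: Gfin.
- by move=> A mA; rewrite IHA// ZE.
Qed.

End independence.

(** * Gaussian tails of the partial sums *)

Section gaussian_tail.
Context d (T : measurableType d) (R : realType) (P : probability T R).

(** The law is prescribed on measurable sets only; the weighted pushforward, with the density as
    weight and the identity as map, carries this to integrals. *)
Lemma integral_comp_normal (X : {mfun T >-> R}) (m s : R) (f : R -> R) :
  has_law P X (normal_prob m s) ->
  measurable_fun setT f -> (forall x, 0 <= f x) ->
  (\int[P]_w (f (X w))%:E =
   \int[lebesgue_measure]_x (normal_pdf m s x * f x)%:E)%E.
Proof.
move=> lawX mf f0.
rewrite -(ge0_integral_distribution (P := P) X (f := EFin \o f))//; last first.
  exact/measurable_EFinP.
rewrite -(@ge0_integral_weighted_pushforward _ (measurableTypeR R) _ _ R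
  lebesgue_measure (distribution P X) (normal_pdf m s) id f)//.
- exact: measurable_normal_pdf.
- by move=> x; exact: normal_pdf_ge0.
- move=> A mA; apply: (etrans _ (esym (lawX A mA))).
  rewrite /= /normal_prob [RHS]integral_mkcond.
  apply: eq_integral => x _; rewrite patchE indicE.
  by case: ifP; rewrite ?mulr1 ?mulr0.
Qed.

(** Completing the square: tilting by [expR (t * x)] moves the mean to [m + t * s ^+ 2] and leaves a
    constant factor. *)
Lemma normal_mgf (X : {mfun T >-> R}) (m s t : R) : s != 0 ->
  has_law P X (normal_prob m s) ->
  (\int[P]_w (expR (t * X w))%:E = (expR (t * m + t ^+ 2 * s ^+ 2 / 2))%:E)%E.
Proof.
move=> s0 lawX.
rewrite (integral_comp_normal (f := fun x => expR (t * x)) lawX)//; last first.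
  by apply: measurableT_comp => //; exact: measurable_funM.
under eq_integral => x _.
  rewrite (_ : normal_pdf m s x * expR (t * x) =
    expR (t * m + t ^+ 2 * s ^+ 2 / 2) * normal_pdf (m + t * s ^+ 2) s x); last first.
    rewrite !normal_pdfE// /normal_fun [RHS]mulrCA -[LHS]mulrA; congr (_ * _).
    by rewrite -!expRD; congr expR; field.
  rewrite EFinM; over.
rewrite ge0_integralZl//=.
- by rewrite integral_normal_pdf mule1.
- by apply/measurable_EFinP; exact: measurable_normal_pdf.
- by move=> x _; rewrite lee_fin normal_pdf_ge0.
Qed.

(** Indicators give way to functions one variable at a time: first [f (X w)] against an indicator of
    [Y], then [g (Y w)]. *)
Lemma expectationM_indep (X Y : {mfun T >-> R}) (f g : R -> R) :
  independent_pair P X Y ->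
  measurable_fun setT f -> (forall x, 0 <= f x) ->
  measurable_fun setT g -> (forall x, 0 <= g x) ->
  (\int[P]_w (f (X w))%:E)%E \is a fin_num ->
  (\int[P]_w (f (X w) * g (Y w))%:E =
   \int[P]_w (f (X w))%:E * \int[P]_w (g (Y w))%:E)%E.
Proof.
move=> indep mf f0 mg g0 fin.
have mXA (Z : {mfun T >-> R}) A : measurable A -> measurable (Z @^-1` A).
  by move=> mA; rewrite -[_ @^-1` _]setTI; exact: measurable_funP.
have mind (Z : {mfun T >-> R}) A : measurable A ->
    measurable_fun setT (fun w => \1_A (Z w) : R).
  by move=> mA; apply: (measurableT_comp _ (@measurable_funPT _ _ _ _ Z)); exact: measurable_indic.
have int1 (Z : {mfun T >-> R}) A : measurable A ->
    (\int[P]_w (\1_A (Z w))%:E)%E = P (Z @^-1` A).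
  by move=> mA; rewrite (integral_indic _ _ (mXA Z _ mA))//= setIT.
apply: integralM_comp_indep => //.
- exact: measurableT_comp.
- move=> B mB; under eq_integral do rewrite mulrC.
  rewrite integralM_comp_indep//.
  + by rewrite int1// muleC.
  + exact: mind.
  + by rewrite int1// fin_num_measure//; exact: mXA.
  + move=> A mA; rewrite int1// muleC -[RHS]indep//.
    rewrite -[X in _ = P X]setIT -integral_indic//; last first.
      by apply: measurableI; exact: mXA.
    by apply: eq_integral => w _; rewrite indicI mulrC.
Qed.

(** A difference has mean [mu1 - mu0] and variance [2 * s ^+ 2]; its transform factors over the two
    streams, and the pairs multiply by independence. *)
Lemma two_stream_mgf (X Y : nat -> {mfun T >-> R}) (mu0 mu1 s t : R) n :
  s != 0 -> two_stream_normal P X Y mu0 mu1 s ->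
  (\int[P]_w (expR (t * \sum_(i < n) (Y i w - X i w)))%:E =
   (expR (n%:R * (t * (mu1 - mu0) + t ^+ 2 * s ^+ 2)))%:E)%E.
Proof.
move=> s0 [indep indepXY lawX lawY].
have mexp (c : R) : measurable_fun setT (fun x : R => expR (c * x)).
  by apply: measurableT_comp => //; exact: measurable_funM.
pose G (_ : nat) (p : R * R) := expR (- t * p.1) * expR (t * p.2).
have GE i : (\int[P]_w (G i (X i w, Y i w))%:E =
    (expR (t * (mu1 - mu0) + t ^+ 2 * s ^+ 2))%:E)%E.
  rewrite /G (expectationM_indep (f := fun x => expR (- t * x))
    (g := fun x => expR (t * x)) (indepXY i))//=; last first.
    by rewrite (normal_mgf _ s0 (lawX i)).
  rewrite (normal_mgf _ s0 (lawX i)) (normal_mgf _ s0 (lawY i)).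
  by rewrite -EFinM -expRD; congr (expR _)%:E; field.
transitivity (\int[P]_w (\prod_(i < n) G i (X i w, Y i w))%:E)%E.
  apply: eq_integral => w _; rewrite mulr_sumr expR_sum; congr EFin.
  by apply: eq_bigr => i _; rewrite /G -expRD /=; congr expR; ring.
rewrite (expectation_prod_indep (W := fun n w => (X n w, Y n w)))//.
- under eq_bigr do rewrite GE.
  by rewrite prodEFin big_const_ord iter_mulr_1 expRM_natl.
- by move=> i; exact: measurable_fun_pair.
- move=> i; apply: measurable_funM.
    by apply: (measurableT_comp (mexp _)); exact: measurable_fst.
  by apply: (measurableT_comp (mexp _)); exact: measurable_snd.
- by move=> i p; rewrite mulr_ge0// expR_ge0.
- by move=> i; rewrite GE.
Qed.

Lemma two_stream_tail (X Y : nat -> {mfun T >-> R}) (mu0 mu1 s t : R) n :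
  0 < s -> two_stream_normal P X Y mu0 mu1 s -> (0 < n)%N -> 0 < t ->
  (P [set w | (t <= `|\sum_(i < n) (Y i w - X i w) - n%:R * (mu1 - mu0)|)%R ]
   <= (2 * expR (- (t ^+ 2 / (4 * s ^+ 2 * n%:R))))%:E)%E.
Proof.
move=> s0 model n0 t0.
have nR0 : (0 : R) < n%:R by rewrite ltr0n.
pose V (e : R) w := e * (\sum_(i < n) (Y i w - X i w) - n%:R * (mu1 - mu0)).
have mV e : measurable_fun setT (V e).
  apply: measurable_funM => //; apply: measurable_funB => //.
  by apply: measurable_sum => i; exact: measurable_funB.
pose Vm e : {mfun T >-> R} := HB.pack (V e) (isMeasurableFun.Build _ _ _ _ (V e) (mV e)).
(* The Chernoff parameter minimising [n%:R * r ^+ 2 * s ^+ 2 - r * t]. *)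
pose r := t / (2 * s ^+ 2 * n%:R).
have r0 : 0 < r by rewrite divr_gt0// !mulr_gt0// exprn_gt0.
(* The sign [e] selects the upper or the lower tail. *)
have tail e : e ^+ 2 = 1 ->
    (P [set w | (t <= V e w)%R] <= (expR (- (t ^+ 2 / (4 * s ^+ 2 * n%:R))))%:E)%E.
  move=> e2; have := chernoff (P := P) (Vm e) t r0.
  rewrite /mmt_gen_fun unlock /= => /le_trans; apply.
  have -> : (\int[P]_w (expR (V e w * r))%:E =
      (expR (n%:R * (r ^+ 2 * s ^+ 2)))%:E)%E.
    transitivity (\int[P]_w ((expR (- (e * r * (n%:R * (mu1 - mu0)))))%:E *
        (expR ((e * r) * \sum_(i < n) (Y i w - X i w)))%:E))%E.
      apply: eq_integral => w _; rewrite -EFinM -expRD; congr (expR _)%:E.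
      by rewrite /V; ring.
    rewrite ge0_integralZl//.
    - rewrite (two_stream_mgf _ _ (lt0r_neq0 s0) model) -EFinM -expRD.
      by congr (expR _)%:E; rewrite (_ : (e * r) ^+ 2 = r ^+ 2) ?exprMn ?e2 ?mul1r//; ring.
    - apply/measurable_EFinP; apply: measurableT_comp => //.
      apply: measurable_funM => //.
      by apply: measurable_sum => i; exact: measurable_funB.
  rewrite -EFinM lee_fin -expRD ler_expR /r le_eqVlt; apply/orP; left.
  by apply/eqP; field; rewrite !gt_eqF.
have mset (f : T -> R) : measurable_fun setT f -> measurable [set w | t <= f w].
  by move=> mf; rewrite -[X in measurable X]setTI; exact: measurable_fun_le.
apply: (@le_trans _ _ (P ([set w | t <= V 1 w] `|` [set w | t <= V (-1) w]))).
  apply: le_measure; rewrite ?inE.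
  - apply: mset; under eq_fun do rewrite -[X in `|X|]mul1r.
    exact: measurableT_comp (mV 1).
  - by apply: measurableU; exact: mset.
  - by move=> w /=; rewrite /V mul1r mulN1r ler_normr => /orP.
apply: (le_trans (measureU2 _ (mset _ (mV 1)) (mset _ (mV (-1))))).
by rewrite mulr2n mulrDl !mul1r EFinD leeD// tail// ?expr1n// sqrrN expr1n.
Qed.

End gaussian_tail.

(** * The mixture likelihood ratio *)

Section mixture_bounds.
Context (R : realType).

Lemma lr_powE (s D th : R) n : 0 < s ->
  (phi ((D - th) / (s * Num.sqrt 2)) / phi (D / (s * Num.sqrt 2))) ^+ n =
  expR (n%:R * (D ^+ 2 - (D - th) ^+ 2) / (4 * s ^+ 2)).
Proof.
move=> s0; rewrite /phi !normal_pdfE ?oner_neq0// /normal_fun.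
have p0 : normal_peak (1 : R) != 0 by rewrite gt_eqF// normal_peak_gt0 ?oner_neq0.
rewrite -mulf_div divff// mul1r -expRN -expRD -expRM_natl; congr expR.
rewrite !subr0 !expr_div_n !exprMn sqr_sqrtr// expr1n.
by field; rewrite gt_eqF.
Qed.

(** The exponent is largest at [theta = D], and [H] has total mass 1. *)
Lemma mixture_lr_le (s : R) (H : probability (measurableTypeR R) R)
    (x y : nat -> R) n : 0 < s ->
  (mixture_lr s H x y n <=
   (expR (n%:R * mean_diff x y n ^+ 2 / (4 * s ^+ 2)))%:E)%E.
Proof.
move=> s0; rewrite /mixture_lr; set D := mean_diff x y n.
have -> : (expR (n%:R * D ^+ 2 / (4 * s ^+ 2)))%:E =
    (\int[H]_(_ in setT) (expR (n%:R * D ^+ 2 / (4 * s ^+ 2)))%:E)%E.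
  by rewrite integral_cst//= probability_setT mule1.
apply: ge0_le_integral_nonmeasurable => th.
  by rewrite lee_fin lr_powE ?expR_ge0.
rewrite lee_fin lr_powE// ler_expR ler_pM2r ?invr_gt0 ?mulr_gt0 ?exprn_gt0//.
by rewrite ler_wpM2l// lerBlDr lerDl sqr_ge0.
Qed.

(** For a mixing value [v] within [eta] of [th], the bounds [|D - v| <= 2 * eta] and
    [|D| >= |th| - eta] control the exponent; the other values only add to the integral. *)
Lemma mixture_lr_ge (s : R) (H : probability (measurableTypeR R) R)
    (x y : nat -> R) n (th eta : R) :
  0 < s -> eta <= `|th| -> `|mean_diff x y n - th| <= eta ->
  ((expR (n%:R * ((`|th| - eta) ^+ 2 - 4 * eta ^+ 2) / (4 * s ^+ 2)))%:E *
     H `[(th - eta)%R, (th + eta)%R]%classic <= mixture_lr s H x y n)%E.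
Proof.
move=> s0 eta_th; rewrite /mixture_lr; set D := mean_diff x y n => Dth.
have eta0 : 0 <= eta by exact: le_trans Dth.
set k := expR _.
have -> : (k%:E * H `[(th - eta)%R, (th + eta)%R]%classic =
    \int[H]_x
      (k * \1_(`[th - eta, th + eta]%classic : set (measurableTypeR R)) x)%:E)%E.
  under eq_integral do rewrite EFinM.
  rewrite ge0_integralZl//=.
  - by rewrite integral_indic// setIT.
  - by apply/measurable_EFinP; exact: measurable_indic.
  - by rewrite lee_fin expR_ge0.
apply: ge0_le_integral_nonmeasurable => v.
  by rewrite lee_fin mulr_ge0// expR_ge0.
rewrite lee_fin lr_powE// indicE.
have [|_] := boolP (v \in _); last by rewrite mulr0 expR_ge0.
rewrite inE/= in_itv/= mulr1 => /andP[v1 v2].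
rewrite ler_expR ler_pM2r ?invr_gt0 ?mulr_gt0 ?exprn_gt0//.
rewrite ler_wpM2l//.
have Dv : (D - v) ^+ 2 <= 4 * eta ^+ 2.
  move: Dth; rewrite ler_norml => /andP[d1 d2]; nra.
have DD : (`|th| - eta) ^+ 2 <= D ^+ 2.
  rewrite -[leRHS]real_normK ?num_real// ler_sqr ?nnegrE ?subr_ge0//.
  rewrite lerBlDr -lerBlDl (le_trans _ Dth)// distrC; exact: lerB_dist.
lra.
Qed.

(** Length times least density, uniformly in [g]: the peak is smallest at scale [g1], the
    exponential factor at distance [K] and scale [g0]. *)
Lemma normal_prob_itv_ge (g g0 g1 K th eta : R) :
  0 < g0 -> g0 <= g -> g <= g1 -> 0 <= eta -> `|th| + eta <= K ->
  ((2 * eta * (normal_peak g1 * expR (- (K ^+ 2 / (g0 ^+ 2 *+ 2)))))%:E <=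
   normal_prob 0%R g `[(th - eta)%R, (th + eta)%R])%E.
Proof.
move=> g00 g0g gg1 eta0 thK; rewrite /normal_prob.
have gg : 0 < g by exact: lt_le_trans g0g.
have g10 : 0 < g1 by exact: lt_le_trans gg1.
set c := normal_peak g1 * _.
have c0 : 0 <= c by rewrite mulr_ge0 ?normal_peak_ge0 ?expR_ge0.
apply: (@le_trans _ _ (\int[lebesgue_measure]_(x in `[(th - eta)%R, (th + eta)%R]) c%:E)%E).
  rewrite integral_cst//= lebesgue_measure_itv/= lte_fin muleC.
  case: ifPn => [_|].
    by rewrite -EFinB -EFinM lee_fin le_eqVlt; apply/orP; left; apply/eqP; ring.
  rewrite -leNgt => h; rewrite mul0e lee_fin.
  by rewrite (_ : eta = 0) ?mulr0 ?mul0r//; lra.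
apply: ge0_le_integral => //.
  by apply/measurable_EFinP/measurable_funTS; exact: measurable_normal_pdf.
move=> x /=; rewrite in_itv/= => /andP[x1 x2].
rewrite lee_fin normal_pdfE ?gt_eqF// ler_pM ?expR_ge0 ?normal_peak_ge0//.
  rewrite lef_pV2 ?posrE ?sqrtr_gt0 ?mulrn_wgt0 ?mulr_gt0 ?pi_gt0 ?exprn_gt0//.
  by rewrite ler_wsqrtr// lerMn2r/= ler_wpM2r ?pi_ge0// ler_sqr ?nnegrE// ltW.
rewrite ler_expR subr0 mulNr lerN2 ler_pM ?sqr_ge0 ?invr_ge0 ?mulrn_wge0 ?sqr_ge0//.
  rewrite -[leLHS]real_normK ?num_real// ler_sqr ?nnegrE.
  - by rewrite ler_norml; move: thK; case: ger0P => th0 thK; apply/andP; split; lra.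
  - by [].
  - by rewrite (le_trans _ thK)// addr_ge0.
by rewrite lef_pV2 ?posrE ?mulrn_wgt0 ?exprn_gt0// lerMn2r/= ler_sqr ?nnegrE// ltW.
Qed.

Lemma mSPRT_time_ge (s : R) (H : probability (measurableTypeR R) R)
    (alpha a : R) (x y : nat -> R) :
  (forall n, (0 < n)%N -> (alpha^-1%:E <= mixture_lr s H x y n)%E -> a <= n%:R) ->
  (a%:E <= mSPRT_time s H alpha x y)%E.
Proof.
move=> h; apply: le_ereal_inf_tmp => _ [n [n0 ncross] <-].
by rewrite lee_fin; exact: h.
Qed.

Lemma mSPRT_time_le (s : R) (H : probability (measurableTypeR R) R)
    (alpha : R) (x y : nat -> R) n :
  (0 < n)%N -> (alpha^-1%:E <= mixture_lr s H x y n)%E ->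
  (mSPRT_time s H alpha x y <= (n%:R)%:E)%E.
Proof. by move=> n0 cross; apply: ereal_inf_lbound; exists n. Qed.

End mixture_bounds.

(** * The Mills ratio and the range of [gamma_star] *)

Section mills_ratio.
Context (R : realType).
Local Notation phi := (@phi R).
Local Notation Phi := (@Phi R).

Lemma phiE (x : R) : phi x = normal_peak 1 * expR (- (x ^+ 2 / 2)).
Proof.
rewrite /Defs.phi normal_pdfE ?oner_neq0// /normal_fun subr0 expr1n mulNr.
by rewrite mulr2n.
Qed.

Lemma phi_gt0 (x : R) : 0 < phi x.
Proof. by rewrite phiE mulr_gt0 ?expR_gt0// normal_peak_gt0 ?oner_neq0. Qed.

Lemma phi_ge0 (x : R) : 0 <= phi x.
Proof. exact: ltW (phi_gt0 x). Qed.

Lemma ler_phi (x y : R) : 0 <= x -> x <= y -> phi y <= phi x.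
Proof.
move=> x0 xy; rewrite !phiE ler_wpM2l ?normal_peak_ge0// ler_expR lerN2.
by rewrite ler_pM2r// ler_sqr// nnegrE (le_trans x0).
Qed.

Lemma continuous_phi : continuous phi.
Proof. by apply: continuous_normal_pdf; exact: oner_neq0. Qed.

Lemma is_derive_phi (x : R) : is_derive x 1 (fun x => - phi x) (x * phi x).
Proof.
under eq_fun do rewrite phiE.
have h : is_derive x 1 (fun x : R => - (x ^+ 2 / 2)) (- x).
  apply: is_derive_eq.
  by rewrite /GRing.scale/=; field.
apply: is_derive_eq.
by rewrite phiE /GRing.scale/=; ring.
Qed.

Lemma cvg_phi_y : phi x @[x --> +oo] --> (0 : R).
Proof.
under eq_fun do rewrite phiE.
rewrite -(mulr0 (normal_peak 1)); apply: cvgMr.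
apply: (@cvg_comp _ _ _ (fun x : R => x ^+ 2 / 2) (fun x => expR (- x)) _ +oo%R).
  apply/cvgryPge => A; near=> x.
  have xA : 1 + 2 * `|A| <= x by near: x; exact: nbhs_pinfty_ge.
  have := ler_norm A; have := normr_ge0 A; nra.
exact: cvgr_expR.
Unshelve. all: by end_near. Qed.

(** [- phi] is an antiderivative of [x * phi x] and vanishes at infinity. *)
Lemma integral_phi_first_moment (b : R) : 0 <= b ->
  (\int[lebesgue_measure]_(x in `[b, +oo[) (x * phi x)%:E = (phi b)%:E)%E.
Proof.
move=> b0.
rewrite (@ge0_continuous_FTC2y _ _ (fun x => - phi x) _ 0)//.
- by rewrite EFinN oppeK add0e.
- by move=> x bx; rewrite mulr_ge0 ?(le_trans b0 bx)// phi_ge0.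
- apply: continuous_subspaceT => x; apply: cvgM; first exact: cvg_id.
  exact: continuous_phi.
- by rewrite -oppr0; exact: (cvgN cvg_phi_y).
- by move=> x _; have [] := is_derive_phi x.
- apply: cvg_at_right_filter; apply: (@continuousN _ R^o); exact: continuous_phi.
- by move=> x _; rewrite derive1E; have [_] := is_derive_phi x.
Qed.

Lemma PhiN (b : R) :
  ((Phi (- b))%:E = \int[lebesgue_measure]_(x in `[b, +oo[) (phi x)%:E)%E.
Proof.
rewrite /Defs.Phi fineK ?fin_num_measure// /normal_prob.
rewrite ge0_integration_by_substitutionNy.
- by apply: eq_integral => x _ /=; rewrite -!/(Defs.phi _) !phiE sqrrN.
- by apply: continuous_subspaceT; exact: continuous_phi.
- by move=> x _; exact: normal_pdf_ge0.
Qed.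

(** A Mills bound with a gap uniform in [b]: [phi b - b * Phi (- b)] is the integral of
    [(x - b) * phi x] over [x >= b], and the stretch from [B + 1] to [B + 2], where [x - b >= 1],
    contributes at least [phi (B + 2)]. *)
Lemma mills_gap (b B : R) : 0 < b -> b <= B ->
  b * Phi (- b) + phi (B + 2) <= phi b.
Proof.
move=> b0 bB; rewrite -lee_fin EFinD EFinM PhiN -(integral_phi_first_moment (ltW b0)).
have mphi D : measurable_fun D phi.
  by apply: measurable_funTS; exact: measurable_normal_pdf.
rewrite -ge0_integralZl//; last 3 first.
- by apply/measurable_EFinP; exact: mphi.
- by move=> x _; rewrite lee_fin phi_ge0.
- by rewrite lee_fin ltW.
have -> : (phi (B + 2))%:E = (\int[lebesgue_measure]_(x in `[b, +oo[)
    (phi (B + 2) * \1_(`[B + 1, B + 2]%classic) x)%:E)%E.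
  under eq_integral do rewrite EFinM.
  rewrite ge0_integralZl//; last 2 first.
  - by apply/measurable_EFinP; exact: measurable_indic.
  - by rewrite lee_fin phi_ge0.
  rewrite integral_indic// setIidl; last first.
    by move=> x /=; rewrite !in_itv/= andbT => /andP[h _]; lra.
  rewrite /= lebesgue_measure_itv/= lte_fin ltrD2l ltr1n -EFinB.
  by rewrite (_ : B + 2 - (B + 1) = 1) ?mule1//; ring.
have mind D : measurable_fun D
    (fun x : R => phi (B + 2) * \1_(`[B + 1, B + 2]%classic : set R) x).
  by apply: measurable_funM => //; exact: measurable_indic.
have mbphi D : measurable_fun D (fun x : R => (b%:E * (phi x)%:E)%E).
  by apply: measurable_funeM; apply/measurable_EFinP; exact: mphi.
rewrite -ge0_integralD//; last 4 first.
- by move=> x _; rewrite -EFinM lee_fin mulr_ge0 ?phi_ge0 ?(ltW b0)//.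
- exact: mbphi.
- by move=> x _; rewrite lee_fin mulr_ge0 ?phi_ge0 ?(ltW b0)//.
- by apply/measurable_EFinP; exact: mind.
apply: ge0_le_integral => //.
- by move=> x _; rewrite -EFinM -EFinD lee_fin addr_ge0// mulr_ge0 ?phi_ge0 ?(ltW b0)//.
- apply: emeasurable_funD; first exact: mbphi.
  by apply/measurable_EFinP; exact: mind.
- apply/measurable_EFinP; apply: measurable_funM; last exact: mphi.
  exact: measurable_id.
move=> x /=; rewrite in_itv/= andbT => bx; rewrite -EFinM -EFinD lee_fin indicE.
have phix := phi_gt0 x.
have [|_] := boolP (x \in _); last first.
  by rewrite mulr0 addr0 ler_wpM2r// ltW.
rewrite inE/= in_itv/= mulr1 => /andP[x1 x2].
have : phi (B + 2) <= phi x by apply: ler_phi => //; lra.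
by nra.
Qed.

End mills_ratio.

Section gamma_star_bounds.
Context (R : realType).
Local Notation phi := (@phi R).
Local Notation Phi := (@Phi R).

Lemma Phi_le1 (x : R) : Phi x <= 1.
Proof.
rewrite /Defs.Phi -lee_fin fineK ?fin_num_measure//.
exact: probability_le1.
Qed.

(** The half-line below [- b] contains the interval of radius 1 around [- (B + 1)]. *)
Lemma PhiN_ge (b B : R) : 0 <= b -> b <= B ->
  2 * (normal_peak 1 * expR (- ((B + 2) ^+ 2 / 2))) <= Phi (- b).
Proof.
move=> b0 bB; rewrite -lee_fin /Defs.Phi fineK ?fin_num_measure//.
have := @normal_prob_itv_ge R 1 1 1 (B + 2) (- (B + 1)) 1 ltr01 (lexx _) (lexx _) ler01.
rewrite expr1n mulr1 mulr2n -[1 + 1]/(2 : R) => /(_ _)/le_trans; apply.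
  by rewrite normrN ger0_norm; lra.
apply: le_measure; rewrite ?inE// => x /=.
by rewrite !in_itv/= => /andP[_ ?]; lra.
Qed.

Lemma gamma_star_bounds (s tau b0 B : R) : 0 < tau -> 0 < b0 -> b0 <= B ->
  exists g0 g1, [/\ 0 < g0, 0 < g1 & forall M alpha,
    b0 <= bcoef s tau M alpha -> bcoef s tau M alpha <= B ->
    g0 <= gamma_star s tau M alpha <= g1].
Proof.
move=> tau0 b00 b0B.
have B0 : 0 < B by exact: lt_le_trans b0B.
set c1 := 2 * (normal_peak 1 * expR (- ((B + 2) ^+ 2 / 2))) : R.
have c10 : 0 < c1 by rewrite !mulr_gt0 ?expR_gt0// normal_peak_gt0 ?oner_neq0.
have p0 := phi_gt0 (0 : R).
have pB := phi_gt0 (B + 2).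
(* The numerator in [gamma_star] lies between [c1] and 1, the denominator between [phi (B + 2) / B],
   by the Mills gap, and [phi 0 / b0]. *)
exists (Num.sqrt (tau ^+ 2 * (c1 * (b0 / phi 0)))), (Num.sqrt (tau ^+ 2 * (B / phi (B + 2)))).
have t20 : 0 < tau ^+ 2 by rewrite exprn_gt0.
split.
- by rewrite sqrtr_gt0 (mulr_gt0 t20)// (mulr_gt0 c10)// divr_gt0.
- by rewrite sqrtr_gt0 (mulr_gt0 t20)// divr_gt0.
move=> M alpha; rewrite /gamma_star; set b := bcoef _ _ _ _ => b0b bB.
have bp : 0 < b by exact: lt_le_trans b0b.
have gap := mills_gap bp bB.
have P1 := Phi_le1 (- b).
have P2 : c1 <= Phi (- b) by apply: PhiN_ge => //; exact: ltW.
have pb : phi b <= phi 0 by apply: ler_phi => //; exact: ltW.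
have D1 : phi (B + 2) / B <= b^-1 * phi b - Phi (- b).
  rewrite -(ler_pM2l bp) mulrBr mulVKf ?gt_eqF//.
  apply: (@le_trans _ _ (phi (B + 2))); last by rewrite lerBrDl.
  by rewrite mulrA ler_pdivrMr// mulrC ler_pM2l.
have D2 : b^-1 * phi b - Phi (- b) <= phi 0 / b0.
  apply: (@le_trans _ _ (b^-1 * phi b)).
    by rewrite lerBlDr lerDl (le_trans (ltW c10)).
  have ib : 0 <= b^-1 by rewrite invr_ge0 ltW.
  have ibb : b^-1 <= b0^-1 by rewrite lef_pV2 ?posrE.
  by rewrite mulrC ler_pM// phi_ge0.
have D0 : 0 < b^-1 * phi b - Phi (- b).
  by apply: lt_le_trans D1; rewrite divr_gt0.
have iD0 : 0 <= (b^-1 * phi b - Phi (- b))^-1 by rewrite invr_ge0 ltW.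
apply/andP; split; rewrite ler_wsqrtr// ler_pM2l//.
- apply: ler_pM => //; first exact: ltW.
    by rewrite divr_ge0// ltW.
  by rewrite -invf_div lef_pV2 ?posrE ?divr_gt0.
- rewrite -[leRHS]mul1r; apply: ler_pM => //; first exact: le_trans (ltW c10) _.
  by rewrite -[leRHS]invf_div lef_pV2 ?posrE ?divr_gt0.
Qed.

End gamma_star_bounds.

(** * Run-length at a fixed effect *)

Section run_length_bounds.
Context d (T : measurableType d) (R : realType) (P : probability T R).
Context (X Y : nat -> {mfun T >-> R}).

Local Notation Sn n w := (\sum_(i < n) (Y i w - X i w)).

(* [Num.min 1 (kap / th ^ 2)], written so that it equals [1] at [th = 0]; with
   [kap = 4 s^2 L / M] it is the leading-order relative run-length. *)
Definition oracle_fraction (kap th : R) : R := kap / Num.max kap (th ^+ 2).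

Lemma oracle_fraction_gt0 kap th : 0 < kap -> 0 < oracle_fraction kap th.
Proof. by move=> k0; rewrite divr_gt0// lt_max k0. Qed.

Lemma oracle_fraction_le1 kap th : 0 < kap -> oracle_fraction kap th <= 1.
Proof. by move=> k0; rewrite ler_pdivrMr ?mul1r ?le_max ?lexx// lt_max k0. Qed.

Lemma sum_mean_diff (x y : nat -> R) n : (0 < n)%N ->
  \sum_(i < n) (y i - x i) = n%:R * mean_diff x y n.
Proof. by move=> n0; rewrite /mean_diff mulVKf// pnatr_eq0 -lt0n. Qed.

(* Whatever the mixing distribution, the mixture does not exceed the maximal
   likelihood ratio, so a crossing at [n] forces [|S_n| >= 2 s sqrt (n L)]. *)
Lemma crossing_time_ge (s L q th : R) (H : probability (measurableTypeR R) R)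
    (x y : nat -> R) M n :
  0 < s -> 0 < L -> 0 <= q <= 1 -> (0 < M)%N -> (0 < n)%N ->
  ((expR L)%:E <= mixture_lr s H x y n)%E ->
  ((n <= M)%N -> `|\sum_(i < n) (y i - x i) - n%:R * th| <
    2 * q * s * Num.sqrt (L * n%:R)) ->
  (1 - q) ^+ 2 * oracle_fraction (4 * s ^+ 2 * L / M%:R) th * M%:R <= n%:R.
Proof.
move=> s0 L0 /andP[q0 q1] M0 n0 cross close.
have MR : (0 : R) < M%:R by rewrite ltr0n.
have nR : (0 : R) < n%:R by rewrite ltr0n.
set kap := 4 * s ^+ 2 * L / M%:R.
have k0 : 0 < kap by rewrite divr_gt0// !mulr_gt0// exprn_gt0.
have q1' : (1 - q) ^+ 2 <= 1 by nra.
(* After [M] the claim is trivial, both factors in front of [M%:R] being at most 1. *)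
have [nM|Mn] := leqP n M; last first.
  apply: (@le_trans _ _ M%:R); last by rewrite ler_nat ltnW.
  by rewrite ler_piMl// mulr_ile1 ?sqr_ge0 ?oracle_fraction_le1// ltW ?oracle_fraction_gt0.
have {close} := close nM; have := le_trans cross (mixture_lr_le H x y n s0).
rewrite lee_fin ler_expR ler_pdivlMr ?mulr_gt0 ?exprn_gt0//.
rewrite (sum_mean_diff x y n0); set D := mean_diff x y n => LD close.
pose r := Num.sqrt (L * n%:R).
have r0 : 0 < r by rewrite sqrtr_gt0 mulr_gt0.
have r2 : r ^+ 2 = L * n%:R by rewrite sqr_sqrtr// ltW// mulr_gt0.
have SD : 2 * s * r <= `|n%:R * D|.
  rewrite -ler_sqr ?nnegrE ?normr_ge0//; last by rewrite ltW// !mulr_gt0.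
  rewrite real_normK ?num_real//.
  have -> : (2 * s * r) ^+ 2 = n%:R * (L * (4 * s ^+ 2)) by rewrite !exprMn r2; ring.
  have -> : (n%:R * D) ^+ 2 = n%:R * (n%:R * D ^+ 2) by ring.
  by rewrite ler_wpM2l// ltW.
(* Triangle inequality: the sum has size at least [2 * s * r] and misses [n%:R * th] by less than
   [q] times that. *)
have nth : (1 - q) * (2 * s * r) <= n%:R * `|th|.
  rewrite -[n%:R]gtr0_norm// -normrM.
  have := lerB_dist (n%:R * D) (n%:R * th).
  by rewrite -/r in close; move=> h; nra.
(* The previous bound squared, with one factor [n] cancelled; [kap * M%:R] is [4 * s ^+ 2 * L]. *)
have nth2 : (1 - q) ^+ 2 * (kap * M%:R) <= n%:R * th ^+ 2.
  rewrite -(ler_pM2l nR) divfK ?gt_eqF//.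
  rewrite -[th ^+ 2]real_normK ?num_real//.
  have -> : n%:R * ((1 - q) ^+ 2 * (4 * s ^+ 2 * L)) = ((1 - q) * (2 * s * r)) ^+ 2.
    by rewrite !exprMn r2; ring.
  have -> : n%:R * (n%:R * `|th| ^+ 2) = (n%:R * `|th|) ^+ 2 by ring.
  rewrite ler_sqr ?nnegrE//.
  by rewrite !mulr_ge0 ?subr_ge0 ?(ltW s0) ?(ltW r0).
rewrite /oracle_fraction mulrA -mulrA [_^-1 * _]mulrC mulrA ler_pdivrMr ?lt_max ?k0//.
by rewrite -mulrA (le_trans nth2)// ler_wpM2l// le_max lexx orbT.
Qed.

Lemma measurable_dev t n c :
  measurable [set w | t <= `|Sn n w - c|].
Proof.
rewrite -[X in measurable X]setTI; apply: measurable_fun_le => //.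
apply: measurableT_comp => //; apply: measurable_funB => //.
by apply: measurable_sum => i; exact: measurable_funB.
Qed.

Lemma relative_run_length_le1 (s : R) (H : probability (measurableTypeR R) R)
    (M : nat) (alpha : R) : (0 < M)%N ->
  (relative_run_length P X Y s H M alpha <= 1)%E.
Proof.
move=> M0; have MR : (0 : R) < M%:R by rewrite ltr0n.
rewrite /relative_run_length lee_pdivrMr// mul1e.
apply: (@le_trans _ _ (\int[P]_(_ in setT) (M%:R)%:E)%E); last first.
  by rewrite integral_cst//= probability_setT mule1.
apply: ge0_le_integral_nonmeasurable => w; last by rewrite ge_min lexx orbT.
rewrite le_min lee_fin ler0n andbT.
by apply: mSPRT_time_ge => n _ _; rewrite ler0n.
Qed.

Lemma relative_run_length_ge0 (s : R) (H : probability (measurableTypeR R) R)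
    (M : nat) (alpha : R) : (0 <= relative_run_length P X Y s H M alpha)%E.
Proof.
rewrite mule_ge0 ?lee_fin ?invr_ge0 ?ler0n//; apply: integral_ge0 => w _.
rewrite le_min lee_fin ler0n andbT.
by apply: mSPRT_time_ge => n _ _; rewrite ler0n.
Qed.

(** Off the deviation events at times 1 to [M], each of probability at most
    [2 * expR (- (q ^+ 2 * L))], the truncated time is at least [A]; on them the bound 0 is used. *)
Lemma relative_run_length_ge (mu0 mu1 s q alpha : R)
    (H : probability (measurableTypeR R) R) M :
  two_stream_normal P X Y mu0 mu1 s -> 0 < s -> 0 < alpha < 1 -> 0 < q <= 1 ->
  (0 < M)%N ->
  (((1 - q) ^+ 2 *
    oracle_fraction (4 * s ^+ 2 * ln alpha^-1 / M%:R) (mu1 - mu0) *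
    (1 - 2 * M%:R * expR (- (q ^+ 2 * ln alpha^-1))))%:E
   <= relative_run_length P X Y s H M alpha)%E.
Proof.
move=> model s0 /andP[a0 a1] /andP[q0 q1] M0.
have MR : (0 : R) < M%:R by rewrite ltr0n.
have L0 : 0 < ln alpha^-1 by rewrite ln_gt0// invf_gt1.
have aE : alpha^-1 = expR (ln alpha^-1) by rewrite lnK// posrE invr_gt0.
set L := ln alpha^-1 in L0 aE *; set th := mu1 - mu0.
set rr := oracle_fraction _ _.
have k0 : 0 < 4 * s ^+ 2 * L / M%:R by rewrite divr_gt0// !mulr_gt0// exprn_gt0.
have rr0 : 0 < rr by exact: oracle_fraction_gt0.
pose A := (1 - q) ^+ 2 * rr * M%:R.
have A0 : 0 <= A by rewrite mulr_ge0// mulr_ge0 ?sqr_ge0// ltW.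
(* [B n] concerns time [n.+1], so that the union over [n < M] covers the times 1 to [M]. *)
pose B n := [set w | 2 * q * s * Num.sqrt (L * n.+1%:R) <=
   `|Sn n.+1 w - n.+1%:R * th|].
have mB n : measurable (B n) by exact: measurable_dev.
have PB n : (P (B n) <= (2 * expR (- (q ^+ 2 * L)))%:E)%E.
  have nR : (0 : R) < n.+1%:R by rewrite ltr0n.
  have := two_stream_tail (t := 2 * q * s * Num.sqrt (L * n.+1%:R)) s0 model (ltn0Sn n).
  rewrite !mulr_gt0 ?sqrtr_gt0 ?mulr_gt0// => /(_ isT)/le_trans; apply.
  rewrite lee_fin le_eqVlt; apply/orP; left; apply/eqP.
  congr (_ * expR (- _)); rewrite !exprMn sqr_sqrtr ?mulr_ge0 ?ltW//.
  by field; rewrite !gt_eqF.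
pose E := \big[setU/set0]_(n < M) B n.
have mE : measurable E by apply: bigsetU_measurable => n _; exact: mB.
have PE : (P E <= (2 * M%:R * expR (- (q ^+ 2 * L)))%:E)%E.
  apply: (le_trans (Boole_inequality P (fun i _ => mB i))).
  apply: (@le_trans _ _ (\sum_(n < M) (2 * expR (- (q ^+ 2 * L)))%:E)%E).
    by apply: lee_sum => n _; exact: PB.
  rewrite sumEFin lee_fin sumr_const card_ord -mulr_natr.
  by rewrite le_eqVlt; apply/orP; left; apply/eqP; ring.
rewrite /relative_run_length lee_pdivlMr//.
apply: (@le_trans _ _ (\int[P]_w (A * \1_(~` E) w)%:E)%E).
  under eq_integral do rewrite EFinM.
  rewrite ge0_integralZl//; last first.
    by apply/measurable_EFinP; apply: measurable_indic; exact: measurableC.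
  rewrite (integral_indic _ _ (measurableC mE))//= setIT probability_setC//.
  rewrite -EFinM.
  have PEf : P E = (fine (P E))%:E by rewrite fineK// fin_num_measure.
  move: PE; rewrite PEf -EFinB -EFinM !lee_fin => PE.
  have -> : (1 - q) ^+ 2 * rr * (1 - 2 * M%:R * expR (- (q ^+ 2 * L))) * M%:R =
     A * (1 - 2 * M%:R * expR (- (q ^+ 2 * L))) by rewrite /A; ring.
  by rewrite ler_wpM2l// lerB.
apply: ge0_le_integral_nonmeasurable => w.
  by rewrite lee_fin mulr_ge0.
rewrite indicE le_min; have [wE|_] := boolP (w \in _); last first.
  rewrite mulr0 lee_fin ler0n andbT.
  by apply: mSPRT_time_ge => n _ _; rewrite ler0n.
rewrite mulr1; apply/andP; split; last first.
  rewrite lee_fin /A ler_piMl// mulr_ile1 ?sqr_ge0 ?oracle_fraction_le1 ?(ltW rr0)//.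
  by nra.
apply: mSPRT_time_ge => n n0; rewrite aE => cross.
apply: (crossing_time_ge s0 L0 _ M0 n0 cross); first by rewrite ltW.
move=> nM; rewrite ltNge; apply/negP => wn.
move: wE; rewrite inE; apply; rewrite /E -bigcup_mkord.
by case: n n0 nM wn {cross} => // n _ nM wn; exists n.
Qed.

End run_length_bounds.

(** * Upper bound on the run-length at a fixed effect *)

Section run_length_upper_bound.
Context d (T : measurableType d) (R : realType).
Context (X Y : nat -> {mfun T >-> R}).

Local Notation Sn n w := (\sum_(i < n) (Y i w - X i w)).

(** A single time [n] suffices: the truncated time is at most [n] when the sum is close to its mean
    there, and at most [M] on the tail event. *)
Lemma relative_run_length_le_tail (P : probability T R) (mu0 mu1 s t alpha : R)
    (H : probability (measurableTypeR R) R) (M n : nat) :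
  two_stream_normal P X Y mu0 mu1 s -> 0 < s -> 0 < t -> (0 < M)%N -> (0 < n)%N ->
  (forall w, `|Sn n w - n%:R * (mu1 - mu0)| < t ->
    (alpha^-1%:E <= mixture_lr s H (X ^~ w) (Y ^~ w) n)%E) ->
  (relative_run_length P X Y s H M alpha <=
   (n%:R / M%:R + 2 * expR (- (t ^+ 2 / (4 * s ^+ 2 * n%:R))))%:E)%E.
Proof.
move=> model s0 t0 M0 n0 cross; have MR : (0 : R) < M%:R by rewrite ltr0n.
rewrite /relative_run_length lee_pdivrMr// -EFinM mulrDl divfK ?gt_eqF//.
pose B := [set w | t <= `|Sn n w - n%:R * (mu1 - mu0)|].
have mB : measurable B by exact: measurable_dev.
apply: (@le_trans _ _ (\int[P]_w (n%:R%:E + (M%:R * \1_B w)%:E))%E).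
  apply: ge0_le_integral_nonmeasurable => w.
    rewrite le_min lee_fin ler0n andbT.
    by apply: mSPRT_time_ge => k _ _; rewrite ler0n.
  rewrite indicE -EFinD; have [wB|wB] := boolP (w \in B).
    by rewrite ge_min mulr1 lee_fin lerDr ler0n orbT.
  rewrite mulr0 addr0 ge_min; apply/orP; left.
  apply: mSPRT_time_le => //; apply: cross; rewrite ltNge; apply/negP => h.
  by move/negP: wB; apply; rewrite inE.
have mM1 : measurable_fun setT (fun w => (M%:R * \1_B w)%:E : \bar R).
  by apply/measurable_EFinP; apply: measurable_funM => //; exact: measurable_indic.
rewrite ge0_integralD//.
rewrite integral_cst//= probability_setT mule1 EFinD leeD2l//.
under eq_integral do rewrite EFinM.
rewrite ge0_integralZl//; last first.
  by apply/measurable_EFinP; exact: measurable_indic.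
rewrite (integral_indic _ _ mB)//= setIT mulrC EFinM lee_wpmul2l//.
exact: two_stream_tail.
Qed.

(** With [a] the size of [th], the bracket [a ^+ 2 - 2 * a * eta - 3 * eta ^+ 2] is at least
    [(1 - 5 * lam) * a ^+ 2], and [lam] solves [(1 - 5 * lam) * (1 + del) = 1 + del / 2]: half of
    the surplus [del] survives. *)
Lemma crossing_exponent (s L del lam th eta : R) n :
  0 < s -> 0 < L -> 0 < del -> lam = del / (10 * (1 + del)) -> 0 <= eta ->
  eta <= lam * `|th| -> (1 + del) * (4 * s ^+ 2 * L) <= n%:R * th ^+ 2 ->
  (1 + del / 2) * L <=
  n%:R * ((`|th| - eta) ^+ 2 - 4 * eta ^+ 2) / (4 * s ^+ 2).
Proof.
move=> s0 L0 del0 lamE eta0 etath nth.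
have s20 : 0 < 4 * s ^+ 2 by rewrite mulr_gt0// exprn_gt0.
have lamd : lam * (10 * (1 + del)) = del by rewrite lamE divfK// gt_eqF//; lra.
have lam0 : 0 < lam by rewrite lamE divr_gt0//; lra.
have lam1 : 5 * lam <= 1 by nra.
rewrite ler_pdivlMr//.
set a := `|th| in etath *.
have a0 : 0 <= a by rewrite /a.
have a2 : th ^+ 2 = a ^+ 2 by rewrite /a real_normK ?num_real.
have quad : (1 - 5 * lam) * a ^+ 2 <= (a - eta) ^+ 2 - 4 * eta ^+ 2.
  have e1 : eta * a <= lam * a ^+ 2 by rewrite expr2 mulrA ler_wpM2r.
  have e2 : eta ^+ 2 <= lam * a ^+ 2.
    have : eta * eta <= eta * a by rewrite ler_wpM2l//; nra.
    by rewrite -expr2 => /le_trans; apply.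
  nra.
rewrite a2 in nth.
apply: (@le_trans _ _ ((1 - 5 * lam) * (n%:R * a ^+ 2))).
  have h := ler_wpM2l (_ : 0 <= 1 - 5 * lam) nth.
  apply: le_trans (h _); last by rewrite subr_ge0.
  have -> : (1 - 5 * lam) * ((1 + del) * (4 * s ^+ 2 * L)) =
    (1 + del - lam * (10 * (1 + del)) / 2) * (4 * s ^+ 2 * L) by field.
  by rewrite lamd le_eqVlt; apply/orP; left; apply/eqP; field.
by rewrite mulrCA ler_wpM2l.
Qed.

(** [L0] precedes the sampling law, the effect and the scale, so that the bound can be integrated
    over the prior. *)
Lemma relative_run_length_le_eventually (s C del K g0 g1 e : R) :
  0 < s -> 0 < C -> 0 < del -> 0 < K -> 0 < g0 -> 0 < g1 -> 0 < e ->
  exists2 L0 : R, 0 < L0 &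
  forall (P : probability T R) (mu0 mu1 alpha g : R) (M : nat),
    two_stream_normal P X Y mu0 mu1 s ->
    0 < alpha -> L0 <= ln alpha^-1 -> (0 < M)%N -> M%:R <= C * ln alpha^-1 ->
    `|mu1 - mu0| <= K -> g0 <= g -> g <= g1 ->
    (relative_run_length P X Y s (normal_prob 0%R g) M alpha <=
     ((1 + 2 * del) *
        oracle_fraction (4 * s ^+ 2 * ln alpha^-1 / M%:R) (mu1 - mu0)
      + e)%:E)%E.
Proof.
move=> s0 C0 del0 K0 g00 g10 e0.
pose lam := del / (10 * (1 + del)).
have lam0 : 0 < lam by rewrite divr_gt0//; lra.
(* Outside the trivial case, [th ^+ 2 > kap >= th0 ^+ 2] because [M%:R <= C * L]; this permits a
   width [eta] independent of [th]. *)
pose th0 := 2 * s / Num.sqrt C.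
have th00 : 0 < th0 by rewrite divr_gt0 ?mulr_gt0 ?sqrtr_gt0.
pose eta := lam * th0.
have eta0 : 0 < eta by rewrite mulr_gt0.
(* Lower bound on the mixing mass within [eta] of any effect of size at most [K]. *)
pose c := 2 * eta * (normal_peak g1 * expR (- ((K + eta) ^+ 2 / (g0 ^+ 2 *+ 2)))).
have c0 : 0 < c.
  have pk : 0 < normal_peak g1 by rewrite normal_peak_gt0 ?gt_eqF.
  by apply: mulr_gt0; [exact: mulr_gt0|rewrite mulr_gt0 ?expR_gt0].
have s20 : 0 < 4 * s ^+ 2 by rewrite mulr_gt0// exprn_gt0.
(* [L1] makes room for rounding [n] up, [L2] lets the surplus exponent outweigh the mass [c], and
   [L3] brings the tail below [e]. *)
pose L1 := K ^+ 2 / (4 * s ^+ 2 * del).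
pose L2 := 2 / (del * c).
pose L3 := 2 * K ^+ 2 / (eta ^+ 2 * e).
have K20 : 0 < K ^+ 2 by rewrite exprn_gt0.
have eta20 : 0 < eta ^+ 2 by rewrite exprn_gt0.
have L10 : 0 < L1 by rewrite divr_gt0// mulr_gt0.
have L20 : 0 < L2 by rewrite divr_gt0// mulr_gt0.
have L30 : 0 < L3 by rewrite divr_gt0// mulr_gt0.
exists (L1 + L2 + L3); first by rewrite !addr_gt0.
move=> P mu0 mu1 alpha g M model al0; set L := ln alpha^-1 => LL M0 MC.
set th := mu1 - mu0 => thK g0g gg1.
have MR : (0 : R) < M%:R by rewrite ltr0n.
have aE : alpha^-1 = expR L by rewrite lnK// posrE invr_gt0.
have L0 : 0 < L by lra.
set kap := 4 * s ^+ 2 * L / M%:R.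
have kap0 : 0 < kap by rewrite divr_gt0// mulr_gt0.
set rr := oracle_fraction kap th.
have rr0 : 0 < rr by exact: oracle_fraction_gt0.
have [big|small] := leP 1 ((1 + 2 * del) * rr).
  apply: (le_trans (relative_run_length_le1 _ _ _ _ _ _ M0)).
  by rewrite lee_fin; lra.
have kapth : kap < th ^+ 2.
  rewrite ltNge; apply/negP => h; move: small; rewrite /rr /oracle_fraction.
  by rewrite max_l// divff ?gt_eqF//; lra.
have th20 : 0 < th ^+ 2 by exact: lt_trans kapth.
have rrE : rr = kap / th ^+ 2 by rewrite /rr /oracle_fraction max_r// ltW.
have th2K : th ^+ 2 <= K ^+ 2.
  by rewrite -[leLHS]real_normK ?num_real// ler_sqr ?nnegrE// ltW.
have th0th : th0 <= `|th|.
  rewrite -ler_sqr ?nnegrE ?(ltW th00)// real_normK ?num_real//.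
  apply: le_trans (ltW kapth); rewrite /th0 expr_div_n sqr_sqrtr ?(ltW C0)//.
  rewrite ler_pdivrMr// /kap mulrAC ler_pdivlMr//.
  have -> : (2 * s) ^+ 2 = 4 * s ^+ 2 by ring.
  have -> : 4 * s ^+ 2 * L * C = 4 * s ^+ 2 * (C * L) by ring.
  by have := ler_wpM2l (ltW s20) MC; lra.
(* The leading-order crossing time; [n] below exceeds [(1 + del) * a], and its rounding costs at
   most [1 <= del * a]. *)
pose a := 4 * s ^+ 2 * L / th ^+ 2.
have a0 : 0 < a by rewrite divr_gt0// mulr_gt0.
have aM : a = rr * M%:R.
  by rewrite rrE /a [RHS]mulrAC /kap divfK ?gt_eqF.
pose n := (Num.truncn ((1 + del) * a)).+1.
have n1 : (1 + del) * a < n%:R by exact: truncnS_gt.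
have n2 : n%:R <= (1 + 2 * del) * a.
  have da1 : 1 <= del * a.
    rewrite /a mulrA ler_pdivlMr// mul1r (le_trans th2K)//.
    have : L1 <= L by lra.
    rewrite ler_pdivrMr ?mulr_gt0// => /le_trans; apply.
    by rewrite le_eqVlt; apply/orP; left; apply/eqP; ring.
  have := truncn_le ((1 + del) * a).
  rewrite mulr_ge0 ?(ltW a0)//; last lra.
  by rewrite /n -natr1; lra.
have n0 : (0 < n)%N by [].
have nR : (0 : R) < n%:R by rewrite ltr0n.
have t0 : 0 < n%:R * eta by rewrite mulr_gt0.
have etath : eta <= lam * `|th| by rewrite ler_wpM2l// ltW.
have := relative_run_length_le_tail (alpha := alpha) (H := normal_prob 0%R g) model s0 t0 M0 n0.
move=> bound; apply: le_trans (bound _) _ => {bound}.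
- move=> w; have /= -> := sum_mean_diff (X ^~ w) (Y ^~ w) n0.
  rewrite -mulrBr normrM gtr0_norm// ltr_pM2l// => Dw.
  have lam1 : lam <= 1 by rewrite ler_pdivrMr//; lra.
  apply: le_trans (mixture_lr_ge _ s0 _ (ltW Dw)); last first.
    by apply: (le_trans etath); rewrite ler_piMl.
  have mass : (c%:E <= normal_prob 0%R g `[(th - eta)%R, (th + eta)%R])%E.
    by apply: normal_prob_itv_ge => //; [exact: ltW|rewrite lerD2r].
  apply: le_trans (lee_wpmul2l _ mass); last by rewrite lee_fin expR_ge0.
  rewrite -EFinM lee_fin aE.
  have ex : (1 + del / 2) * L <=
      n%:R * ((`|th| - eta) ^+ 2 - 4 * eta ^+ 2) / (4 * s ^+ 2).
    apply: (crossing_exponent s0 L0 del0 (erefl lam) (ltW eta0) etath).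
    by rewrite -ler_pdivrMr// -[leLHS]mulrA (ltW n1).
  apply: (@le_trans _ _ (expR ((1 + del / 2) * L) * c)); last first.
    by rewrite ler_pM2r// ler_expR.
  (* The factor [expR L] meets the threshold; the remaining [expR (del / 2 * L) * c] is at least 1
     by the choice of [L2]. *)
  rewrite mulrDl mul1r expRD -mulrA ler_peMr ?expR_ge0//.
  have := expR_ge1Dx (del / 2 * L) => h.
  apply: le_trans (ler_wpM2r (ltW c0) h).
  have : L2 <= L by lra.
  rewrite ler_pdivrMr ?(mulr_gt0 del0 c0)// => L2L.
  have -> : (1 + del / 2 * L) * c = c + L * (del * c) / 2 by field.
  lra.
- rewrite lee_fin lerD//.
    by rewrite ler_pdivrMr// -mulrA -aM.
  set x := (n%:R * eta) ^+ 2 / _.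
  have xE : x = n%:R * eta ^+ 2 / (4 * s ^+ 2).
    by rewrite /x; field; rewrite !gt_eqF.
  (* Together with [expR x >= 1 + x] this gives [2 * expR (- x) <= e]. *)
  have xL : 2 / e <= x.
    rewrite xE ler_pdivlMr//.
    apply: (@le_trans _ _ (a * eta ^+ 2)); last by rewrite ler_pM2r//; nra.
    have : L3 <= L by lra.
    rewrite ler_pdivrMr ?(mulr_gt0 eta20 e0)// => KL.
    have thL : 2 * th ^+ 2 <= L * (eta ^+ 2 * e) by lra.
    rewrite /a -[leRHS]mulrA [_^-1 * _]mulrC [leRHS]mulrA ler_pdivlMr//.
    have -> : 2 / e * (4 * s ^+ 2) * th ^+ 2 = 4 * s ^+ 2 * (2 * th ^+ 2) / e by ring.
    rewrite ler_pdivrMr//.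
    have -> : 4 * s ^+ 2 * L * eta ^+ 2 * e = 4 * s ^+ 2 * (L * (eta ^+ 2 * e)) by ring.
    by rewrite ler_wpM2l// ltW.
  have x0 : 0 < x by apply: lt_le_trans xL; rewrite divr_gt0.
  rewrite expRN -ler_pdivlMl// -[leRHS]invrK lef_pV2 ?posrE ?expR_gt0 ?invr_gt0
    ?mulr_gt0 ?invr_gt0//.
  have := expR_ge1Dx x; rewrite invfM invrK; lra.
Qed.

End run_length_upper_bound.

(** * Run-length averaged over the prior *)

Section prior.
Context d (T : measurableType d) (R : realType) (prior : probability T R).

Lemma tight_tail (X : {mfun T >-> R}) (e : R) : 0 < e ->
  exists2 K : R, 0 < K & (prior [set p | (K < `|X p|)%R] <= e%:E)%E.
Proof.
move=> e0.
have mX : measurable_fun setT (fun p => `|X p|) by exact: measurableT_comp.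
pose Xm : {mfun T >-> R} := HB.pack (fun p => `|X p|)
  (isMeasurableFun.Build _ _ _ _ _ mX).
have := cvg_ccdfy0 (P := prior) Xm => /fine_cvgP[_ /cvgr0Pnorm_lt/(_ _ e0) ne].
case: ne => r [_ rP]; pose K := Num.max r 0 + 1.
exists K; first by rewrite ltr_wpDl// le_max lexx orbT.
have /rP /= : r < K by rewrite ltr_pwDr// le_max lexx.
rewrite ger0_norm; last by rewrite fine_ge0// /ccdf measure_ge0.
move=> /ltW; rewrite -lee_fin fineK; last by rewrite fin_num_measure.
rewrite /ccdf /distribution /pushforward.
suff -> : Xm @^-1` `]K, +oo[ = [set p | K < `|X p|] by [].
by apply/seteqP; split => p /=; rewrite in_itv/= andbT.
Qed.

Lemma measurable_oracle_fraction (X : {mfun T >-> R}) (kap : R) : 0 < kap ->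
  measurable_fun setT (fun p => oracle_fraction kap (X p)).
Proof.
move=> k0; pose g p := Num.max kap (X p ^+ 2).
have mg : measurable_fun setT g.
  by apply: measurable_maxr => //; exact: measurable_funX.
(* The reciprocal of the positive [g] becomes a composition of measurable functions. *)
have -> : (fun p => oracle_fraction kap (X p)) = (fun p => kap * expR (- ln (g p))).
  by apply/funext => p; rewrite expRN lnK// posrE /g lt_max k0.
apply: measurable_funM => //; apply: measurableT_comp => //.
apply: measurableT_comp => //; exact: measurableT_comp (@measurable_ln R) mg.
Qed.

Lemma oracle_mean_le1 (X : {mfun T >-> R}) (kap : R) : 0 < kap ->
  (\int[prior]_p (oracle_fraction kap (X p))%:E <= 1)%E.
Proof.
move=> k0; apply: (@le_trans _ _ (\int[prior]_(_ in setT) 1)%E); last first.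
  by rewrite integral_cst//= probability_setT mule1.
apply: ge0_le_integral_nonmeasurable => p; rewrite lee_fin.
  exact/ltW/oracle_fraction_gt0.
exact: oracle_fraction_le1.
Qed.

Lemma measurable_tail (X : {mfun T >-> R}) (K : R) :
  measurable [set p | K < `|X p|].
Proof.
rewrite (_ : [set p | _] = ~` [set p | `|X p| <= K]).
  apply: measurableC; rewrite -[X in measurable X]setTI.
  by apply: measurable_fun_le => //; exact: measurableT_comp.
by apply/seteqP; split => p /=; rewrite ltNge => /negP.
Qed.

(** Only values of size at most [K], of prior mass at least [1 - e], are counted. *)
Lemma oracle_mean_ge (X : {mfun T >-> R}) (kap K c e : R) : 0 < kap -> 0 <= c ->
  (prior [set p | (K < `|X p|)%R] <= e%:E)%E ->
  (forall th, `|th| <= K -> c <= oracle_fraction kap th) ->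
  ((c * (1 - e))%:E <= \int[prior]_p (oracle_fraction kap (X p))%:E)%E.
Proof.
move=> k0 c0 tail hc; have mA := measurable_tail X K.
set A := [set p | _] in tail mA *.
apply: (@le_trans _ _ (\int[prior]_p (c * \1_(~` A) p)%:E)%E).
  under eq_integral do rewrite EFinM.
  rewrite ge0_integralZl//; last first.
    by apply/measurable_EFinP; apply: measurable_indic; exact: measurableC.
  rewrite (integral_indic _ _ (measurableC mA))//= setIT probability_setC//.
  rewrite EFinM lee_wpmul2l// EFinB; apply: leeB => //.
apply: ge0_le_integral_nonmeasurable => p; rewrite lee_fin.
  by rewrite mulr_ge0.
rewrite indicE; have [pA|_] := boolP (p \in _).
  rewrite mulr1; apply: hc; rewrite leNgt; apply/negP => h.
  by move: pA; rewrite inE; apply.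
by rewrite mulr0 ltW// oracle_fraction_gt0.
Qed.

End prior.

Section average_run_length.
Context d (T : measurableType d) (R : realType).
Context (P : R -> R -> probability T R) (X Y : nat -> {mfun T >-> R}).
Context (sigma : R) (prior : probability (R * R)%type R).

Definition effect : {mfun (R * R)%type >-> R} :=
  HB.pack (fun p : R * R => p.1) (isMeasurableFun.Build _ _ (R * R)%type R
    (fun p : R * R => p.1) measurable_fst).

Local Notation oracle_mean kap :=
  (\int[prior]_p (oracle_fraction kap (effect p))%:E)%E.

Hypothesis sigma_gt0 : 0 < sigma.
Hypothesis model : forall mu0 mu1 : R,
  two_stream_normal (P (mu1 - mu0) ((mu0 + mu1) / 2)) X Y mu0 mu1 sigma.

(** Inverts the change of parameters, so that the fixed-effect bounds apply at every point of the
    prior. *)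
Lemma model_at (th mu : R) :
  two_stream_normal (P th mu) X Y (mu - th / 2) (mu + th / 2) sigma.
Proof.
have := model (mu - th / 2) (mu + th / 2).
have -> : mu + th / 2 - (mu - th / 2) = th by field.
by have -> : (mu - th / 2 + (mu + th / 2)) / 2 = mu by field.
Qed.

Lemma rho_le1 (g alpha : R) M : (0 < M)%N ->
  (rho P X Y sigma prior g M alpha <= 1)%E.
Proof.
move=> M0; apply: (@le_trans _ _ (\int[prior]_(_ in setT) 1)%E); last first.
  by rewrite integral_cst//= probability_setT mule1.
apply: ge0_le_integral_nonmeasurable => p.
  exact: relative_run_length_ge0.
exact: relative_run_length_le1.
Qed.

(** [P] carries no measurability in its parameters, so the run-length is compared with the
    measurable oracle fraction by monotonicity alone. *)
Lemma rho_ge (g alpha q : R) M : 0 < alpha < 1 -> 0 < q <= 1 -> (0 < M)%N ->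
  0 <= 1 - 2 * M%:R * expR (- (q ^+ 2 * ln alpha^-1)) ->
  (((1 - q) ^+ 2 * (1 - 2 * M%:R * expR (- (q ^+ 2 * ln alpha^-1))))%:E *
     oracle_mean (4 * sigma ^+ 2 * ln alpha^-1 / M%:R)
   <= rho P X Y sigma prior g M alpha)%E.
Proof.
move=> al q01 M0 pr0.
set kap := 4 * _ * _ / _.
have k0 : 0 < kap.
  case/andP: al => a0 a1.
  by rewrite divr_gt0 ?ltr0n// mulr_gt0 ?mulr_gt0 ?exprn_gt0// ln_gt0// invf_gt1.
have or0 th : 0 <= oracle_fraction kap th by exact/ltW/oracle_fraction_gt0.
have cpr0 : 0 <= (1 - q) ^+ 2 * (1 - 2 * M%:R * expR (- (q ^+ 2 * ln alpha^-1))).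
  by apply: mulr_ge0 => //; exact: sqr_ge0.
rewrite -ge0_integralZl//; last 2 first.
- by apply/measurable_EFinP; exact: measurable_oracle_fraction.
- by move=> p _; rewrite lee_fin.
apply: ge0_le_integral_nonmeasurable => p.
  by rewrite -EFinM lee_fin mulr_ge0.
have := relative_run_length_ge (normal_prob 0 g) (model_at p.1 p.2) sigma_gt0 al q01 M0.
rewrite (_ : p.2 + p.1 / 2 - (p.2 - p.1 / 2) = p.1); last by field.
by rewrite -EFinM -/kap mulrAC.
Qed.

(** Effects beyond [K] have prior mass at most [e] and run-length at most 1; the other [e] is the
    fixed-effect error. *)
Lemma rho_le_eventually (C del g0 g1 e : R) :
  0 < C -> 0 < del -> 0 < g0 -> 0 < g1 -> 0 < e ->
  exists2 L0 : R, 0 < L0 &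
  forall (alpha g : R) (M : nat),
    0 < alpha -> L0 <= ln alpha^-1 -> (0 < M)%N -> M%:R <= C * ln alpha^-1 ->
    g0 <= g -> g <= g1 ->
    (rho P X Y sigma prior g M alpha <=
     (1 + 2 * del)%:E * oracle_mean (4 * sigma ^+ 2 * ln alpha^-1 / M%:R)
     + (e + e)%:E)%E.
Proof.
move=> C0 del0 g00 g10 e0.
have [K K0 tailK] := tight_tail prior effect e0.
have [L0 L00 HL] := relative_run_length_le_eventually X Y sigma_gt0 C0 del0 K0 g00 g10 e0.
exists L0 => // alpha g M al0 LL M0 MC g0g gg1.
set kap := 4 * _ * _ / _.
have k0 : 0 < kap.
  by rewrite divr_gt0 ?ltr0n// mulr_gt0 ?mulr_gt0 ?exprn_gt0//; exact: lt_le_trans LL.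
have or0 th : 0 <= oracle_fraction kap th by exact/ltW/oracle_fraction_gt0.
have mA := measurable_tail effect K.
set A := [set p | _] in tailK mA.
have mor : measurable_fun setT (fun p => (oracle_fraction kap (effect p))%:E).
  by apply/measurable_EFinP; exact: measurable_oracle_fraction.
have d0 : 0 <= 1 + 2 * del by lra.
apply: (@le_trans _ _ (\int[prior]_p (((1 + 2 * del)%:E *
    (oracle_fraction kap (effect p))%:E) + (e + \1_A p)%:E))%E).
  apply: ge0_le_integral_nonmeasurable => p.
    exact: relative_run_length_ge0.
  rewrite indicE -EFinM -EFinD; have [pA|pA] := boolP (p \in A).
    apply: (le_trans (relative_run_length_le1 _ _ _ _ _ _ M0)).
    by rewrite lee_fin mulr1n addrA lerDr addr_ge0 ?(ltW e0)// mulr_ge0.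
  rewrite addr0.
  have := HL _ _ _ alpha g M (model_at p.1 p.2) al0 LL M0 MC.
  rewrite (_ : p.2 + p.1 / 2 - (p.2 - p.1 / 2) = p.1); last by field.
  apply => //; rewrite leNgt; apply/negP => h.
  by move/negP: pA; apply; rewrite inE.
have mA1 : measurable_fun setT (fun p => (\1_A p)%:E : \bar R).
  by apply/measurable_EFinP; exact: measurable_indic.
rewrite ge0_integralD//; last 4 first.
- by move=> p _; rewrite -EFinM lee_fin mulr_ge0.
- exact: measurable_funeM.
- by move=> p _; rewrite lee_fin addr_ge0// ltW.
- by apply/measurable_EFinP; apply: measurable_funD => //; exact: measurable_indic.
rewrite ge0_integralZl//; last by move=> p _; rewrite lee_fin.
rewrite leeD2l//.
under eq_integral do rewrite EFinD.
rewrite ge0_integralD//; last by move=> p _; rewrite lee_fin ltW.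
rewrite integral_cst//= probability_setT mule1 (integral_indic _ _ mA)//= setIT.
by rewrite EFinD leeD2l.
Qed.

End average_run_length.

(** * Comparison of [gamma_star] with an arbitrary mixing scale *)

Theorem proposition6 (R : realType) (d : measure_display)
    (Omega : measurableType d) (sigma tau : R)
    (sigma_gt0 : 0 < sigma) (tau_gt0 : 0 < tau)
    (P : R -> R -> probability Omega R) (X Y : nat -> {mfun Omega >-> R})
    (model : forall mu0 mu1 : R,
      two_stream_normal (P (mu1 - mu0) ((mu0 + mu1) / 2)) X Y mu0 mu1 sigma)
    (prior : probability (R * R)%type R)
    (prior_theta : forall A : set R, measurable A ->
      prior (fst @^-1` A) = normal_prob 0 tau A)
    (C eps : R) (eps_gt0 : 0 < eps) :
  \forall alpha \near 0^'+ & M \near \oo,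
    M%:R <= C * ln alpha^-1 ->
    forall gamma : R, 0 < gamma ->
      (rho P X Y sigma prior (gamma_star sigma tau M alpha) M alpha
       <= (1 + eps)%:E * rho P X Y sigma prior gamma M alpha)%E.
Proof.
have s20 : 0 < 4 * sigma ^+ 2 by rewrite mulr_gt0// exprn_gt0.
have t20 : 0 < 2 * tau ^+ 2 by rewrite mulr_gt0// exprn_gt0.
(* For [C <= 0] the constraint on [M] is contradictory. *)
have [C0|C0] := leP C 0.
  near=> alpha M => MC; exfalso.
  have M0 : (0 < M)%N by near: M; exact: nbhs_infty_gt.
  have a1 : alpha < 1 by near: alpha; exact: nbhs_right_lt.
  have a0 : 0 < alpha by near: alpha; exact: nbhs_right_gt.
  have L0 : 0 < ln alpha^-1 by rewrite ln_gt0// invf_gt1.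
  have : (0 : R) < M%:R by rewrite ltr0n.
  by nra.
(* [a] serves as [q], as prior tail mass and as union bound. As [3 * a * (1 + eps)] is
   [3 * eps / 8], three losses of a factor [1 - a] leave at least [1 + eps / 2] of [1 + eps]. *)
pose a := eps / (8 * (1 + eps)).
have aE : a * (8 * (1 + eps)) = eps by rewrite /a divfK// gt_eqF//; lra.
have a0 : 0 < a by rewrite divr_gt0//; lra.
have a8 : a <= 1 / 8 by nra.
have [K K0 tailK] := tight_tail prior (effect R) a0.
pose kap0 := 4 * sigma ^+ 2 / C.
have kap00 : 0 < kap0 by rewrite divr_gt0.
have K20 : 0 < K ^+ 2 by rewrite exprn_gt0.
(* Lower bound on the oracle fraction at effects up to [K], since [kap >= kap0]; [f0] then bounds
   its prior mean, which turns additive errors into relative ones. *)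
pose c := kap0 / Num.max kap0 (K ^+ 2).
have c0 : 0 < c by rewrite divr_gt0// lt_max kap00.
pose f0 := c * (1 - a).
have f00 : 0 < f0 by rewrite mulr_gt0//; lra.
(* Makes [e + e] at most [eps / 4] times the oracle mean; [del = eps / 8] costs another
   [eps / 4]. *)
pose e := f0 * eps / 8.
have e0 : 0 < e by rewrite divr_gt0// mulr_gt0.
(* [bcoef] is the square root of [kap / (2 * tau ^+ 2)]; [b0] and [B] come from the range of [kap]
   between [kap0] and [K ^+ 2]. *)
pose b0 := Num.sqrt (kap0 / (2 * tau ^+ 2)).
have b00 : 0 < b0 by rewrite sqrtr_gt0 divr_gt0.
pose B := Num.max b0 (Num.sqrt (K ^+ 2 / (2 * tau ^+ 2))).
have b0B : b0 <= B by rewrite le_max lexx.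
have [g0 [g1 [g00 g10 gP]]] := gamma_star_bounds sigma tau_gt0 b00 b0B.
have del0 : 0 < eps / 8 by rewrite divr_gt0.
have [L0 L00 HL] := rho_le_eventually prior sigma_gt0 model C0 del0 g00 g10 e0.
(* Since [expR x >= x ^+ 2 / 2] at [x = a ^+ 2 * L], this brings the union bound below [a]. *)
pose L1 := 4 * C / (a ^+ 4 * a).
have a40 : 0 < a ^+ 4 * a by rewrite mulr_gt0// exprn_gt0.
have L10 : 0 < L1 by rewrite divr_gt0// mulr_gt0.
near=> alpha M => MC gamma gamma_gt0.
have M0 : (0 < M)%N by near: M; exact: nbhs_infty_gt.
have MR : (0 : R) < M%:R by rewrite ltr0n.
have al1 : alpha < 1 by near: alpha; exact: nbhs_right_lt.
have al0 : 0 < alpha by near: alpha; exact: nbhs_right_gt.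
have alL : alpha < expR (- (L0 + L1)).
  by near: alpha; apply: nbhs_right_lt; exact: expR_gt0.
move: MC; set L := ln alpha^-1 => MC.
have LL : L0 + L1 < L.
  by rewrite /L lnV ?posrE// ltrNr -[ltRHS]expRK ltr_ln ?posrE ?expR_gt0.
have Lpos : 0 < L by lra.
pose kap := 4 * sigma ^+ 2 * L / M%:R.
have kappos : 0 < kap by rewrite divr_gt0// mulr_gt0.
have kap0k : kap0 <= kap.
  rewrite ler_pdivrMr// mulrAC ler_pdivlMr//.
  have -> : 4 * sigma ^+ 2 * L * C = 4 * sigma ^+ 2 * (C * L) by ring.
  by rewrite ler_wpM2l// ltW.
have unionbound : 2 * M%:R * expR (- (a ^+ 2 * L)) <= a.
  rewrite expRN ler_pdivrMr ?expR_gt0//.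
  have x0 : 0 <= a ^+ 2 * L by rewrite mulr_ge0 ?sqr_ge0// ltW.
  have := expR_ge1Dxn 1 x0 => h.
  have : L1 <= L by lra.
  rewrite ler_pdivrMr// => h1.
  have h2 : a * ((a ^+ 2 * L) ^+ 2 / 2) <= a * expR (a ^+ 2 * L).
    by rewrite ler_wpM2l ?(ltW a0)//; move: h; rewrite (_ : 2`!%:R = 2 :> R)//; lra.
  apply: le_trans h2.
  have h3 := ler_wpM2l (ltW Lpos) h1.
  have -> : a * ((a ^+ 2 * L) ^+ 2 / 2) = L * (L * (a ^+ 4 * a)) / 2 by field.
  by lra.
set pr := 2 * M%:R * _ in unionbound.
have pr0 : 0 <= 1 - pr by lra.
have q01 : 0 < a <= 1 by apply/andP; split; lra.
have al01 : 0 < alpha < 1 by rewrite al0.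
have lower := rho_ge prior sigma_gt0 model gamma al01 q01 M0 pr0.
set f := (\int[prior]_p _)%E in lower.
have f1 : (f <= 1)%E by exact: oracle_mean_le1.
have fge : (f0%:E <= f)%E.
  apply: (@oracle_mean_ge _ _ _ _ _ _ K) => //; first exact: ltW.
  move=> th thK.
  have th2 : th ^+ 2 <= K ^+ 2.
    by rewrite -[leLHS]real_normK ?num_real// ler_sqr ?nnegrE// ltW.
  rewrite /c /oracle_fraction ler_pdivrMr ?lt_max ?kap00//.
  rewrite mulrAC ler_pdivlMr ?lt_max ?kappos//.
  have m1 : kap0 <= Num.max kap0 (K ^+ 2) by rewrite le_max lexx.
  have m2 : K ^+ 2 <= Num.max kap0 (K ^+ 2) by rewrite le_max lexx orbT.
  case: (leP kap (th ^+ 2)) => _; last by rewrite mulrC ler_wpM2l// ltW.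
  apply: (@le_trans _ _ (kap * th ^+ 2)); first by rewrite ler_wpM2r// sqr_ge0.
  by rewrite ler_wpM2l ?(ltW kappos)// (le_trans th2).
have ffin : f \is a fin_num.
  by rewrite ge0_fin_numE ?(le_lt_trans f1 (ltry 1))// (le_trans _ fge)// lee_fin ltW.
have fE : f = (fine f)%:E by rewrite fineK.
set phi := fine f in fE.
move: f1 fge; rewrite fE !lee_fin => f1 fge.
(* The lower bound replaces the run-length of [gamma], which no longer occurs from here on. *)
apply: le_trans (lee_wpmul2l _ lower); last by rewrite lee_fin; lra.
rewrite fE -!EFinM.
have pra : 1 - a <= 1 - pr by lra.
have main : (1 + eps / 2) * phi <= (1 + eps) * ((1 - a) ^+ 2 * (1 - pr) * phi).
  rewrite mulrA ler_wpM2r ?(le_trans (ltW f00))//.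
  have c3 : (1 - a) ^+ 2 * (1 - a) <= (1 - a) ^+ 2 * (1 - pr).
    by rewrite ler_wpM2l ?sqr_ge0.
  have c4 : 1 - 3 * a <= (1 - a) ^+ 2 * (1 - a) by nra.
  have : (1 + eps) * (1 - 3 * a) <= (1 + eps) * ((1 - a) ^+ 2 * (1 - pr)).
    by rewrite ler_wpM2l//; lra.
  by apply: le_trans; nra.
(* For large [kap] the oracle fraction is 1 at all effects up to [K], and the trivial bound 1 on the
   run-length of [gamma_star] is good enough. *)
have [Kk|kK] := leP (K ^+ 2) kap.
  apply: (le_trans (rho_le1 _ _ _ _ _ _ _ M0)).
  have f2 : 1 - a <= phi.
    rewrite -lee_fin -fE -[X in X%:E]mul1r.
    apply: (@oracle_mean_ge _ _ _ _ _ _ K) => // th thK.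
    rewrite /oracle_fraction max_l ?divff ?gt_eqF// (le_trans _ Kk)//.
    by rewrite -[leLHS]real_normK ?num_real// ler_sqr ?nnegrE// ltW.
  by rewrite lee_fin (le_trans _ main)//; nra.
have /andP[gs0 gs1] : g0 <= gamma_star sigma tau M alpha <= g1.
  have bE : bcoef sigma tau M alpha = Num.sqrt (kap / (2 * tau ^+ 2)).
    rewrite /bcoef /kap -/L; congr Num.sqrt; field.
    by rewrite !gt_eqF.
  apply: gP; rewrite bE.
    by rewrite ler_wsqrtr// ler_pM2r ?invr_gt0.
  by rewrite le_max; apply/orP; right; rewrite ler_wsqrtr// ler_pM2r ?invr_gt0// ltW.
have L0L : L0 <= ln alpha^-1 by rewrite -/L; lra.
apply: (le_trans (HL alpha _ M al0 L0L M0 MC gs0 gs1)).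
rewrite -/L -/kap -/f fE -EFinM -EFinD lee_fin (le_trans _ main)//.
have := ler_wpM2r (ltW eps_gt0) fge; rewrite /e; lra.
Unshelve. all: by end_near. Qed.
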